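(* Suppose $L,M>0$, $\Omega_{z_0}:=\sup_{z\in Z}V(z_0,z)>0$, and that the stochastic mirror-prox sliding (SMPS) method, described in the context, is run for $N$ outer iterations with the parameters $$\gamma_k=\frac{2}{k+1},\quad \beta_k=\frac{2L}{k},\quad T_k=\left\lceil\frac{\sqrt3\,kM}{L}+\frac{Nk^2\sigma^2}{\Omega_{z_0}L^2}\right\rceil,\quad \eta_k^t=\beta_k(t-1)+\frac{LT_k}{k}.$$ Then, in order to compute an approximate solution $\overline z_N$ such that $\sup_{z\in Z}\mathbb E[Q(\overline z_N,z)]\le\varepsilon$, the number of evaluations of the gradient $\nabla G$ and the number of evaluations of the stochastic operator $\mathcal H$ performed by the method are bounded by $$\mathcal O\left(\sqrt{\frac{L\Omega_{z_0}}{\varepsilon}}\right)\quad\text{and}\quad\mathcal O\left(\frac{M\Omega_{z_0}}{\varepsilon}+\frac{\sigma^2\Omega_{z_0}}{\varepsilon^2}+\sqrt{\frac{L\Omega_{z_0}}{\varepsilon}}\right),$$ respectively. That is, there is a universal constant $C$ such that for every $0<\varepsilon\le L\Omega_{z_0}$ there is a number $N$ of outer iterations for which the output satisfies $\sup_{z\in Z}\mathbb E[Q(\overline z_N,z)]\le\varepsilon$, while the total numbers of evaluations of $\nabla G$ and of $\mathcal H$ in the $N$ outer iterations are at most $C\sqrt{L\Omega_{z_0}/\varepsilon}$ and $C\left(M\Omega_{z_0}/\varepsilon+\sigma^2\Omega_{z_0}/\varepsilon^2+\sqrt{L\Omega_{z_0}/\varepsilon}\right)$, respectively.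
   Context: Problem setting. $Z\subseteq\mathbb R^n$ is a nonempty compact convex set, $\|\cdot\|$ is a norm on $\mathbb R^n$ with dual norm $\|\cdot\|_*$. $G:\mathbb R^n\to\mathbb R$ is convex and continuously differentiable, $H:\mathbb R^n\to\mathbb R^n$ is monotone, i.e. $\langle H(u)-H(v),u-v\rangle\ge0$ for all $u,v$, and $$\|\nabla G(w)-\nabla G(v)\|_*\le L\|w-v\|,\qquad \|H(w)-H(v)\|_*\le M\|w-v\|,\qquad\forall w,v\in Z.$$ $J$ is a (simple) real-valued convex function on $Z$, simple meaning that the minimization subproblems below have solutions. The problem is to find $z^*\in Z$ with $\langle \nabla G(z)+H(z),z^*-z\rangle+J(z^* )-J(z)\le0$ for all $z\in Z$. Accuracy is measured by $$Q(\tilde z,z):=G(\tilde z)-G(z)+\langle H(z),\tilde z-z\rangle+J(\tilde z)-J(z).$$ Prox-function. $\pi$ is continuously differentiable on an open set containing $Z$ and strongly convex with respect to $\|\cdot\|$ with parameter $1$, and $V(z,u):=\pi(u)-\pi(z)-\langle\nabla\pi(z),u-z\rangle$ for $z,u\in Z$; thus $V(z,u)\ge\frac12\|z-u\|^2$. Stochastic oracle. $H$ is accessed only through samples $\mathcal H(z;\zeta)$. The random variables $\zeta_k^s$ ($1\le k\le N$, $1\le s\le 2T_k$) are independent and, with $\mathbb E_{\zeta_k^s}$ denoting expectation over $\zeta_k^s$ only (i.e. conditional on all previously drawn samples), for all $k,t$: $\mathbb E_{\zeta_k^{2t-1}}[\mathcal H(z_k^{t-1};\zeta_k^{2t-1})]=H(z_k^{t-1})$,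 $\mathbb E_{\zeta_k^{2t}}[\mathcal H(\tilde z_k^t;\zeta_k^{2t})]=H(\tilde z_k^t)$, $\mathbb E_{\zeta_k^{2t-1}}[\|\mathcal H(z_k^{t-1};\zeta_k^{2t-1})-H(z_k^{t-1})\|_*^2]\le\sigma^2$ and $\mathbb E_{\zeta_k^{2t}}[\|\mathcal H(\tilde z_k^t;\zeta_k^{2t})-H(\tilde z_k^t)\|_*^2]\le\sigma^2$. SMPS method. Inputs: $z_0\in Z$ (deterministic), the number $N\ge1$ of outer iterations, and (deterministic) parameters $\gamma_k$, $\beta_k$, positive integers $T_k$, and $\eta_k^t$ ($1\le k\le N$, $1\le t\le T_k$). Set $\overline z_0=z_0$. For $k=1,\dots,N$: (1) set $\underline z_k=(1-\gamma_k)\overline z_{k-1}+\gamma_k z_{k-1}$ and $z_k^0=z_{k-1}$; (2) for $t=1,\dots,T_k$ compute $$\tilde z_k^t\in\operatorname*{argmin}_{z\in Z}\ \langle\nabla G(\underline z_k)+\mathcal H(z_k^{t-1};\zeta_k^{2t-1}),z\rangle+J(z)+\beta_kV(z_{k-1},z)+\eta_k^tV(z_k^{t-1},z),$$ $$z_k^t\in\operatorname*{argmin}_{z\in Z}\ \langle\nabla G(\underline z_k)+\mathcal H(\tilde z_k^t;\zeta_k^{2t}),z\rangle+J(z)+\beta_kV(z_{k-1},z)+\eta_k^tV(z_k^{t-1},z);$$ (3) set $z_k=z_k^{T_k}$, $\tilde z_k=\frac1{T_k}\sum_{t=1}^{T_k}\tilde z_k^t$, and $\overline z_k=(1-\gamma_k)\overline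 z_{k-1}+\gamma_k\tilde z_k$. Output $\overline z_N$. Outer iteration $k$ uses one evaluation of $\nabla G$ (at $\underline z_k$) and $2T_k$ evaluations of $\mathcal H$. *)

(* Defs.v *)
From HB Require Import structures.
From mathcomp Require Import all_boot all_order all_algebra.
From mathcomp Require Import all_classical all_reals all_analysis.

Set Implicit Arguments.
Unset Strict Implicit.
Unset Printing Implicit Defensive.

Import Order.TTheory GRing.Theory Num.Theory.
Import numFieldNormedType.Exports.

Local Open Scope classical_set_scope.
Local Open Scope ring_scope.

Section euclidean_space.
Context {R : realType} {n : nat}.
Implicit Types (x y u v z : 'rV[R]_n) (Z U : set 'rV[R]_n) (f : 'rV[R]_n -> R).

Definition dot x y : R := \sum_(i < n) x ord0 i * y ord0 i.

(* The library norm of 'rV[R]_n is the max norm; the norm of the problem is an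
   arbitrary function with the following properties. *)
Record is_norm (nrm : 'rV[R]_n -> R) : Prop := IsNorm {
  norm_triangle : forall x y, nrm (x + y) <= nrm x + nrm y ;
  norm_homogeneous : forall (a : R) x, nrm (a *: x) = `|a| * nrm x ;
  norm_definite : forall x, nrm x = 0 -> x = 0
}.

Definition dual_norm (nrm : 'rV[R]_n -> R) x : R :=
  sup [set dot x y | y in [set y | nrm y <= 1]].

Definition grad f x : 'rV[R]_n := \row_i 'D_(delta_mx ord0 i) f x.

Definition cont_diff_on U f :=
  forall x, U x -> differentiable f x /\ {for x, continuous (grad f)}.

Definition monotone_operator (H : 'rV[R]_n -> 'rV[R]_n) :=
  forall u v, 0 <= dot (H u - H v) (u - v).

Definition lipschitz_dual (nrm : 'rV[R]_n -> R) Z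
    (F : 'rV[R]_n -> 'rV[R]_n) (K : R) :=
  forall w v, Z w -> Z v -> dual_norm nrm (F w - F v) <= K * nrm (w - v).

(* strong convexity on Z with parameter 1 *)
Definition strongly_convex_on (nrm : 'rV[R]_n -> R) Z f :=
  forall x y (a : R), Z x -> Z y -> 0 <= a <= 1 ->
    f (a *: x + (1 - a) *: y) <=
      a * f x + (1 - a) * f y - 2^-1 * a * (1 - a) * nrm (x - y) ^+ 2.

Definition prox_function (nrm : 'rV[R]_n -> R) Z f :=
  (exists U, [/\ open U, Z `<=` U & cont_diff_on U f]) /\
  strongly_convex_on nrm Z f.

Definition bregman f z u : R := f u - f z - dot (grad f z) (u - z).

Definition bregman_radius f Z z0 : R := sup [set bregman f z0 z | z in Z].

Definition argmin Z f : set 'rV[R]_n :=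
  [set z | Z z /\ forall y, Z y -> f z <= f y].

Definition gap (G : 'rV[R]_n -> R) (H : 'rV[R]_n -> 'rV[R]_n)
    (J : 'rV[R]_n -> R) (zt z : 'rV[R]_n) : R :=
  G zt - G z + dot (H z) (zt - z) + J zt - J z.

Definition subproblem (J f : 'rV[R]_n -> R) (xi : 'rV[R]_n) (beta eta : R)
    (u v z : 'rV[R]_n) : R :=
  dot xi z + J z + beta * bregman f u z + eta * bregman f v z.

Definition simple_on Z (J f : 'rV[R]_n -> R) :=
  forall xi u v (beta eta : R), Z u -> Z v -> 0 < beta -> 0 < eta ->
    argmin Z (subproblem J f xi beta eta u v) !=set0.

End euclidean_space.

Definition borel_rV (R : realType) (n : nat) :=
  g_sigma_algebraType (@open 'rV[R]_n).

Section stochastics.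
Context {d dX : measure_display} {T : measurableType d} {X : measurableType dX}.
Context {R : realType} (P : probability T R).

Definition mutually_independent (I : eqType) (D : set I) (zeta : I -> T -> X) :=
  forall (s : seq I) (A : I -> set X),
    uniq s -> (forall i, i \in s -> D i) -> (forall i, measurable (A i)) ->
    P (\big[setI/setT]_(i <- s) (zeta i @^-1` A i)) =
      (\prod_(i <- s) P (zeta i @^-1` A i))%E.

(* At the fixed point z, Hs z zeta has mean H z (coordinatewise) and its
   deviation from H z has second moment at most sigma ^+ 2. *)
Definition unbiased_bounded_variance_at {n : nat} (nrm : 'rV[R]_n -> R)
    (H : 'rV[R]_n -> 'rV[R]_n) (Hs : 'rV[R]_n -> X -> 'rV[R]_n) (sigma : R)
    (zeta : T -> X) (z : 'rV[R]_n) :=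
  (forall i, 'E_P[fun w => Hs z (zeta w) ord0 i] = (H z ord0 i)%:E)%E /\
  ('E_P[fun w => (dual_norm nrm (Hs z (zeta w) - H z) ^+ 2)%R]
     <= (sigma ^+ 2)%:E)%E.

End stochastics.

Section smps.
Context {R : realType} {n : nat} {X : Type}.

Record smps_iterates := SmpsIterates {
  z_out : nat -> 'rV[R]_n ;           (* z_k *)
  z_under : nat -> 'rV[R]_n ;         (* \underline z_k *)
  z_bar : nat -> 'rV[R]_n ;           (* \overline z_k *)
  z_tilde : nat -> 'rV[R]_n ;         (* \tilde z_k *)
  z_in : nat -> nat -> 'rV[R]_n ;     (* z_k^t *)
  z_tilde_in : nat -> nat -> 'rV[R]_n (* \tilde z_k^t *)
}.

Record smps_params := SmpsParams {
  gamma_ : nat -> R ;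
  beta_ : nat -> R ;
  T_ : nat -> nat ;
  eta_ : nat -> nat -> R
}.

(* it is a run of N outer iterations on the sample values zeta k s, where
   zeta k s is the s-th sample drawn in outer iteration k. *)
Definition smps_run (Z : set 'rV[R]_n) (G J f : 'rV[R]_n -> R)
    (Hs : 'rV[R]_n -> X -> 'rV[R]_n) (z0 : 'rV[R]_n) (N : nat)
    (p : smps_params) (zeta : nat -> nat -> X) (it : smps_iterates) : Prop :=
  [/\ z_out it 0%N = z0, z_bar it 0%N = z0 &
   forall k, (1 <= k <= N)%N ->
    [/\ z_under it k = (1 - gamma_ p k) *: z_bar it k.-1
                       + gamma_ p k *: z_out it k.-1
          /\ z_in it k 0%N = z_out it k.-1,
        forall t, (1 <= t <= T_ p k)%N ->
          let g := grad G (z_under it k) in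
          let Phi xi := subproblem J f xi (beta_ p k) (eta_ p k t)
                          (z_out it k.-1) (z_in it k t.-1) in
          argmin Z (Phi (g + Hs (z_in it k t.-1) (zeta k (2 * t).-1)))
            (z_tilde_in it k t)
          /\ argmin Z (Phi (g + Hs (z_tilde_in it k t) (zeta k (2 * t)%N)))
               (z_in it k t),
        z_out it k = z_in it k (T_ p k),
        z_tilde it k = (T_ p k)%:R^-1 *:
          \sum_(1 <= t < (T_ p k).+1) z_tilde_in it k t &
        z_bar it k = (1 - gamma_ p k) *: z_bar it k.-1
                     + gamma_ p k *: z_tilde it k]].

Definition sample_index (N : nat) (p : smps_params) : set (nat * nat) :=
  [set ks | (1 <= ks.1 <= N)%N /\ (1 <= ks.2 <= 2 * T_ p ks.1)%N].

Definition grad_evals (N : nat) : nat := (\sum_(1 <= k < N.+1) 1)%N.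

Definition oracle_evals (N : nat) (p : smps_params) : nat :=
  (\sum_(1 <= k < N.+1) 2 * T_ p k)%N.

Definition inner_steps (L M sigma Om : R) (N k : nat) : nat :=
  `|Num.ceil (Num.sqrt 3 * k%:R * M / L
              + N%:R * k%:R ^+ 2 * sigma ^+ 2 / (Om * L ^+ 2))|%N.

Definition sliding_params (L M sigma Om : R) (N : nat) : smps_params :=
  let T := inner_steps L M sigma Om N in
  let beta k := 2 * L / k%:R in
  {| gamma_ := fun k => 2 / k.+1%:R ;
     beta_ := beta ;
     T_ := T ;
     eta_ := fun k t => beta k * (t%:R - 1) + L * (T k)%:R / k%:R |}.

End smps.

Arguments smps_iterates : clear implicits.
Arguments smps_params : clear implicits.

(* Conditions on the samples along a run: the odd sample of an inner step is
   used at z_k^{t-1}, the even one at \tilde z_k^t.  These points depend on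
   earlier samples, so for each outcome w they are frozen and the expectation
   is taken over the new sample only. *)
Definition oracle_along_run {d dX : measure_display} {T : measurableType d}
    {X : measurableType dX} {R : realType} (P : probability T R) {n : nat}
    (nrm : 'rV[R]_n -> R) (H : 'rV[R]_n -> 'rV[R]_n)
    (Hs : 'rV[R]_n -> X -> 'rV[R]_n) (sigma : R) (N : nat)
    (p : smps_params R) (zeta : nat -> nat -> T -> X)
    (it : T -> smps_iterates R n) : Prop :=
  forall k t, (1 <= k <= N)%N -> (1 <= t <= T_ p k)%N ->
    {ae P, forall w, unbiased_bounded_variance_at P nrm H Hs sigma
                       (zeta k (2 * t).-1) (z_in (it w) k t.-1)} /\
    {ae P, forall w, unbiased_bounded_variance_at P nrm H Hs sigma
                       (zeta k (2 * t)%N) (z_tilde_in (it w) k t)}.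

(* Main.v *)
Require Import Defs.
From HB Require Import structures.
From mathcomp Require Import all_boot all_order all_algebra.
From mathcomp Require Import all_classical all_reals all_analysis.
From mathcomp Require Import measurable_realfun ring lra zify.

(** The bound rests on an inequality that holds for every outcome.  In one inner
    step, optimality of the two minimizers ([three_point]), monotonicity and the
    Lipschitz bound on the operator give [inner_step]: up to the sampling errors,
    the gap of the extrapolated point is at most a difference of Bregman
    distances.  Since [eta_ k t.+1 = beta_ k + eta_ k t], these differences
    telescope over the inner loop; the smoothness error of [G] is paid by the
    distance to [z_out k.-1], and convexity transfers the estimate to the averages
    ([outer_step]).  Weighting outer iteration [k] by [k * k.+1] telescopes the
    outer loop as well ([sliding_gap_bound]):
      [N (N + 1) gap <= 6 L V(z0, z) + noise].

    The noise consists of squared dual norms of sampling errors and of the inner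
    product of the error at the extrapolated point with that point minus [z].
    Each iterate is a measurable function of the samples already drawn
    ([adapted_outer]), because a minimizer depends in a Lipschitz way on the data
    of its subproblem ([argmin_lipschitz]).  The next sample is independent of
    them, so by Tonelli's theorem a mean over both is an iterated mean in which the
    iterate is frozen ([indep_tonelli]): the squares have mean at most
    [sigma ^+ 2] and the inner product has mean [0].  The variance part of
    [inner_steps] makes the total noise at most [6 L Om]
    ([sliding_noise_budget]), so the expected gap is at most
    [12 L Om / (N (N + 1))], and [N = ceil (sqrt (12 L Om / eps))] suffices.

    The gap itself may fail to be a measurable function of the outcome: [J] need
    not be lower semicontinuous at points where it has no subgradient, and averages
    of iterates can reach such points.  The pointwise majorant does not involve [J]
    at the iterates, and the integral is monotone for all functions
    ([le_integral_lower]). *)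

Set Implicit Arguments.
Unset Strict Implicit.
Unset Printing Implicit Defensive.

Import Order.TTheory GRing.Theory Num.Theory.
Import numFieldNormedType.Exports.

Local Open Scope classical_set_scope.
Local Open Scope ring_scope.

(** * Euclidean pairing, norms and dual norms *)

Section dot_product.
Context {R : realType} {n : nat}.
Implicit Types (x y z : 'rV[R]_n).

Lemma dotC x y : dot x y = dot y x.
Proof. by apply: eq_bigr => i _; rewrite mulrC. Qed.

Lemma dotDl x y z : dot (x + y) z = dot x z + dot y z.
Proof. by rewrite /dot -big_split; apply: eq_bigr => i _; rewrite mxE mulrDl. Qed.

Lemma dotZl a x y : dot (a *: x) y = a * dot x y.
Proof. by rewrite /dot mulr_sumr; apply: eq_bigr => i _; rewrite mxE mulrA. Qed.

Lemma dotDr x y z : dot z (x + y) = dot z x + dot z y.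
Proof. by rewrite ![dot z _]dotC dotDl. Qed.

Lemma dotZr a x y : dot y (a *: x) = a * dot y x.
Proof. by rewrite ![dot y _]dotC dotZl. Qed.

Lemma dotNl x y : dot (- x) y = - dot x y.
Proof. by rewrite -scaleN1r dotZl mulN1r. Qed.

Lemma dotNr x y : dot y (- x) = - dot y x.
Proof. by rewrite ![dot y _]dotC dotNl. Qed.

Lemma dotBl x y z : dot (x - y) z = dot x z - dot y z.
Proof. by rewrite dotDl dotNl. Qed.

Lemma dotBr x y z : dot z (x - y) = dot z x - dot z y.
Proof. by rewrite dotDr dotNr. Qed.

Lemma dot0l x : dot 0 x = 0.
Proof. by rewrite -(scale0r 0) dotZl mul0r. Qed.

Lemma dot0r x : dot x 0 = 0.
Proof. by rewrite dotC dot0l. Qed.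

Lemma dot_sumr (I : Type) (s : seq I) (F : I -> 'rV[R]_n) x :
  dot x (\sum_(i <- s) F i) = \sum_(i <- s) dot x (F i).
Proof.
elim: s => [|i s IH]; first by rewrite !big_nil dot0r.
by rewrite !big_cons dotDr IH.
Qed.

Definition dotE := (dotDl, dotDr, dotNl, dotNr, dotZl, dotZr).

Lemma dot_delta x i : dot x (delta_mx ord0 i) = x ord0 i.
Proof.
rewrite /dot (bigD1 i)//= big1 ?addr0 ?mxE ?eqxx ?mulr1// => j /negbTE ji.
by rewrite mxE eqxx/= ji mulr0.
Qed.

Lemma ler_coord_norm x i : `|x ord0 i| <= `|x|.
Proof.
rewrite [leRHS]/Num.norm/= mx_normrE.
by apply: (le_bigmax _ (fun ij => `|x ij.1 ij.2|) (ord0, i)).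
Qed.

Lemma ler_norm_coord x a : 0 <= a -> (forall i, `|x ord0 i| <= a) -> `|x| <= a.
Proof.
move=> a0 xa; rewrite [leLHS]/Num.norm/= mx_normrE.
by apply: bigmax_le => // -[i j] _; rewrite (ord1 i).
Qed.

Lemma ler_dot_norm x y : `|dot x y| <= n%:R * `|x| * `|y|.
Proof.
apply: (le_trans (ler_norm_sum _ _ _)).
have -> : n%:R * `|x| * `|y| = \sum_(i < n) (`|x| * `|y|).
  by rewrite sumr_const card_ord -mulrA mulr_natl.
by apply: ler_sum => i _; rewrite normrM ler_pM ?ler_coord_norm.
Qed.

End dot_product.

Section norms.
Context {R : realType} {n : nat} {nrm : 'rV[R]_n -> R}.
Hypothesis Hn : is_norm nrm.
Implicit Types (x y z : 'rV[R]_n).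

Lemma nrm0 : nrm 0 = 0.
Proof. by rewrite -(scale0r 0) (norm_homogeneous Hn) normr0 mul0r. Qed.

Lemma nrmN x : nrm (- x) = nrm x.
Proof. by rewrite -scaleN1r (norm_homogeneous Hn) normrN1 mul1r. Qed.

Lemma nrm_ge0 x : 0 <= nrm x.
Proof.
have := norm_triangle Hn x (- x); rewrite subrr nrm0 nrmN; lra.
Qed.

Lemma nrm_distC x y : nrm (x - y) = nrm (y - x).
Proof. by rewrite -nrmN opprB. Qed.

Lemma nrm_sum (I : Type) (s : seq I) (F : I -> 'rV[R]_n) :
  nrm (\sum_(i <- s) F i) <= \sum_(i <- s) nrm (F i).
Proof.
elim: s => [|i s IH]; first by rewrite !big_nil nrm0.
rewrite !big_cons; apply: (le_trans (norm_triangle Hn _ _)).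
by rewrite lerD2l.
Qed.

Lemma nrm_le_sup_norm : exists2 K, 0 < K & forall x, nrm x <= K * `|x|.
Proof.
exists (1 + \sum_(i < n) nrm (delta_mx ord0 i)) => [|x].
  by rewrite ltr_pwDl// sumr_ge0// => i _; exact: nrm_ge0.
rewrite {1}(row_sum_delta x); apply: (le_trans (nrm_sum _ _)).
rewrite mulrDl mul1r -[leLHS]add0r lerD// mulr_suml.
apply: ler_sum => i _.
by rewrite (norm_homogeneous Hn) mulrC ler_wpM2l ?nrm_ge0// ler_coord_norm.
Qed.

Lemma nrm_continuous : continuous nrm.
Proof.
have [K K0 HK] := nrm_le_sup_norm.
move=> x; apply/(@cvgrPdist_le _ _ _ _ (nbhs_filter x)) => e e0.
rewrite nearE; apply/(@nbhs_normP _ _ (x : [the normedModType R of 'rV[R]_n])).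
exists (e / K) => [|y /= xy]; first by rewrite /= divr_gt0.
have {}xy : K * `|x - y| <= e by rewrite mulrC -ler_pdivlMr// ltW.
apply: le_trans xy.
have t1 := norm_triangle Hn (x - y) y; have t2 := norm_triangle Hn (y - x) x.
have := HK (x - y); rewrite nrm_distC in t2; rewrite !subrK in t1 t2.
rewrite ler_distl; move: t1 t2; lra.
Qed.

(** A norm attains its minimum on the unit sphere of the max norm, which is
    compact, and this minimum is positive. *)
Lemma sup_norm_le_nrm : exists2 K, 0 < K & forall x, `|x| <= K * nrm x.
Proof.
pose S := [set x : 'rV[R]_n | `|x| = 1].
have cS : compact S.
  apply: bounded_closed_compact.
    exists 1; split=> // M M1 x /= ->; exact: ltW.
  have -> : S = (fun x : 'rV[R]_n => `|x|) @^-1` [set x : R | x = 1] by [].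
  apply: closed_comp; last exact: closed_eq.
  by move=> x _; exact: norm_continuous.
(* The sphere is empty when [n = 0]. *)
have [S0|/set0P S0] := eqVneq S set0.
  exists 1 => // x; have [->|x0] := eqVneq x 0.
    by rewrite normr0 mul1r nrm_ge0.
  have : S (`|x|^-1 *: x).
    by rewrite /S/= normrZ normfV normr_id mulVf// normr_eq0.
  by rewrite S0.
have cn : {within S, continuous nrm}.
  by apply: continuous_subspaceT; exact: nrm_continuous.
have [c Sc cmin] := compact_EVT_min S0 cS cn.
have {}Sc : `|c| = 1 by move: Sc; rewrite inE.
have nc : 0 < nrm c.
  rewrite lt_neqAle nrm_ge0 andbT eq_sym; apply/eqP => /(norm_definite Hn) c0.
  by move: Sc; rewrite c0 normr0 => /eqP; rewrite eq_sym oner_eq0.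
exists (nrm c)^-1 => [|x]; first by rewrite invr_gt0.
have [->|x0] := eqVneq x 0; first by rewrite normr0 mulr_ge0// ?invr_ge0 ?nrm_ge0.
have nx : 0 < `|x| by rewrite normr_gt0.
have := cmin (`|x|^-1 *: x); rewrite inE => /(_ _)/wrap[].
  by rewrite /S/= normrZ normfV normr_id mulVf// normr_eq0.
rewrite (norm_homogeneous Hn) normfV normr_id => h.
by rewrite mulrC ler_pdivlMr// -ler_pdivlMl.
Qed.

(* Boundedness of the unit ball of [nrm] is what makes [sup] meaningful here. *)
Let ub_dual x : has_sup [set dot x y | y in [set y | nrm y <= 1]].
Proof.
have [K K0 HK] := sup_norm_le_nrm.
split; first by exists (dot x 0), 0 => //=; rewrite nrm0.
exists (n%:R * `|x| * K) => _ [y /= y1 <-].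
apply: (le_trans (ler_norm _)); apply: (le_trans (ler_dot_norm _ _)).
rewrite ler_wpM2l ?mulr_ge0//; apply: (le_trans (HK _)).
by rewrite -[leRHS]mulr1 ler_wpM2l// ltW.
Qed.

Lemma dual_norm_ge0 x : 0 <= dual_norm nrm x.
Proof.
have := ub_le_sup (proj2 (ub_dual x)); apply.
by exists 0; rewrite /= ?nrm0 ?dot0r.
Qed.

Lemma ler_dot_dual x y : dot x y <= dual_norm nrm x * nrm y.
Proof.
have [y0|y0] := eqVneq (nrm y) 0.
  by rewrite (norm_definite Hn y0) nrm0 mulr0 dot0r.
have ny : 0 < nrm y by rewrite lt_neqAle eq_sym y0 nrm_ge0.
rewrite -ler_pdivrMr//.
have := ub_le_sup (proj2 (ub_dual x)); apply.
exists ((nrm y)^-1 *: y) => /=; last by rewrite dotZr mulrC.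
by rewrite (norm_homogeneous Hn) ger0_norm ?mulVf// invr_ge0 ltW.
Qed.

Lemma dual_norm_lub x a : 0 <= a -> (forall y, dot x y <= a * nrm y) ->
  dual_norm nrm x <= a.
Proof.
move=> a0 xa; apply: ge_sup; first by case: (ub_dual x).
move=> _ [y /= y1 <-]; apply: (le_trans (xa y)).
by rewrite -[leRHS]mulr1 ler_wpM2l.
Qed.

Lemma dual_normD x y : dual_norm nrm (x + y) <= dual_norm nrm x + dual_norm nrm y.
Proof.
apply: dual_norm_lub => [|z]; first by rewrite addr_ge0 ?dual_norm_ge0.
by rewrite dotDl mulrDl lerD// ler_dot_dual.
Qed.

Lemma dual_normN x : dual_norm nrm (- x) = dual_norm nrm x.
Proof.
have h y : dual_norm nrm (- y) <= dual_norm nrm y.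
  apply: dual_norm_lub => [|z]; first exact: dual_norm_ge0.
  by rewrite dotNl -dotNr -[nrm z]nrmN ler_dot_dual.
by apply/eqP; rewrite eq_le h -{1}[x]opprK h.
Qed.

Lemma dual_le_sup_norm : exists2 K, 0 < K & forall x, dual_norm nrm x <= K * `|x|.
Proof.
have [K K0 HK] := sup_norm_le_nrm.
exists (n.+1%:R * K) => [|x]; first by rewrite mulr_gt0.
apply: dual_norm_lub => [|y]; first by rewrite !mulr_ge0// ltW.
apply: (le_trans (ler_norm _)); apply: (le_trans (ler_dot_norm _ _)).
have -> : n.+1%:R * K * `|x| * nrm y = n.+1%:R * `|x| * (K * nrm y) by ring.
by rewrite ler_pM ?mulr_ge0// ler_wpM2r// ler_nat.
Qed.

Lemma sup_norm_le_dual : exists2 K, 0 < K & forall x, `|x| <= K * dual_norm nrm x.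
Proof.
have [K K0 HK] := nrm_le_sup_norm.
exists K => // x; apply: ler_norm_coord => [|i].
  by rewrite mulr_ge0 ?dual_norm_ge0// ltW.
have d1 : `|delta_mx ord0 i : 'rV[R]_n| <= 1.
  by apply: ler_norm_coord => // j; rewrite mxE eqxx/=; case: (j == i); rewrite ?normr1 ?normr0.
have h y : y ord0 i <= K * dual_norm nrm y.
  rewrite -dot_delta; apply: (le_trans (ler_dot_dual _ _)).
  rewrite mulrC ler_wpM2r ?dual_norm_ge0//; apply: (le_trans (HK _)).
  by rewrite -[leRHS]mulr1 ler_wpM2l// ltW.
rewrite ler_norml h andbT lerNl; have := h (- x).
by rewrite mxE dual_normN.
Qed.

End norms.

(** * Convex functions, prox-functions and minimizers *)

Section convexity.
Context {R : realType} {n : nat}.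
Implicit Types (x y z : 'rV[R]_n) (Z : set 'rV[R]_n) (f : 'rV[R]_n -> R).

Lemma convex_set_conv Z x y (a : R) : convex_set Z -> Z x -> Z y ->
  0 <= a <= 1 -> Z (a *: x + (1 - a) *: y).
Proof.
move=> cZ Zx Zy /andP[a0 a1].
by have := cZ x y (Itv01 a0 a1); rewrite !inE; exact.
Qed.

Lemma convex_function_conv Z f x y (a : R) : convex_function Z f -> Z x -> Z y ->
  0 <= a <= 1 -> f (a *: x + (1 - a) *: y) <= a * f x + (1 - a) * f y.
Proof.
move=> cf Zx Zy /andP[a0 a1].
by have := cf (Itv01 a0 a1) x y; rewrite !inE; exact.
Qed.

(** Both conclusions are proved by one induction, whose step splits off the last
    point by a convex combination of two points. *)
Lemma convex_mean Z f (u : nat -> 'rV[R]_n) m :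
  convex_set Z -> convex_function Z f -> (0 < m)%N ->
  (forall t, (1 <= t <= m)%N -> Z (u t)) ->
  let c := (m%:R)^-1 *: \sum_(1 <= t < m.+1) u t in
  Z c /\ f c <= (m%:R)^-1 * \sum_(1 <= t < m.+1) f (u t).
Proof.
move=> cZ cf; elim: m => // -[_ _ Zu|m IH _ Zu] c.
  by rewrite /c !big_nat1 invr1 scale1r mul1r; split => //; exact: Zu.
have [Zc fc] := IH isT (fun t h => Zu t ltac:(by case/andP: h => -> /leqW)).
have Zm : Z (u m.+2) by apply: Zu; rewrite leqnn.
pose a : R := m.+1%:R / m.+2%:R.
have m2 : (m.+2%:R : R) != 0 by rewrite pnatr_eq0.
have m1 : (m.+1%:R : R) != 0 by rewrite pnatr_eq0.
have a01 : 0 <= a <= 1.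
  by rewrite /a divr_ge0//= ler_pdivrMr ?ltr0n// mul1r ler_nat.
have a1 : 1 - a = m.+2%:R^-1.
  by rewrite /a -{1}(divff m2) -mulrBl -natrB// subSnn mul1r.
have am : a * m.+1%:R^-1 = m.+2%:R^-1 by rewrite /a mulrAC divff// mul1r.
have -> : c = a *: (m.+1%:R^-1 *: \sum_(1 <= t < m.+2) u t) + (1 - a) *: u m.+2.
  by rewrite scalerA a1 am -scalerDr -big_nat_recr.
split; first exact: convex_set_conv.
apply: (le_trans (convex_function_conv cf Zc Zm a01)).
rewrite [in leRHS]big_nat_recr//= [leRHS]mulrDr.
have := ler_wpM2l (proj1 (andP a01)) fc.
by rewrite [leRHS]mulrA am -a1 => h; rewrite lerD2r.
Qed.

Lemma derive_dot_grad f x d : differentiable f x -> 'D_d f x = dot (grad f x) d.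
Proof.
move=> fx; rewrite deriveE// {1}(row_sum_delta d) linear_sum /dot.
by apply: eq_bigr => i _; rewrite linearZ /= mxE deriveE// mulrC.
Qed.

(** Gradient inequalities follow from one step [a] that is small enough; the
    bound [a <= e] serves to absorb remainders that are quadratic in [a]. *)
Lemma grad_approx f x d e : differentiable f x -> 0 < e ->
  exists a, [/\ 0 < a, a <= 1, a <= e &
    `|f (x + a *: d) - f x - a * dot (grad f x) d| <= e * a].
Proof.
move=> fx e0; have /cvg_ex[l /= hl] : derivable f x d by exact: diff_derivable.
have lE : dot (grad f x) d = l.
  by rewrite -derive_dot_grad//; exact: cvg_lim hl.
rewrite lE; move/cvgrPdist_le : hl => /(_ _ e0)/nbhs_ballP[r /= r0 hr].
pose a := Num.min (r / 2) (Num.min 1 e).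
have a0 : 0 < a by rewrite /a !lt_min e0 ltr01 divr_gt0.
have ar : a < r by rewrite /a gt_min; apply/orP; left; lra.
exists a; split => //; [by rewrite /a !ge_min lexx orbT| by rewrite /a !ge_min lexx !orbT|].
have := hr a; rewrite /ball/= sub0r normrN gtr0_norm// => /(_ ar (lt0r_neq0 a0)).
rewrite distrC [a *: d + x]addrC => h.
have -> : f (x + a *: d) - f x - a * l = a * (a^-1 *: (f (x + a *: d) - f x) - l).
  by rewrite mulrBr -[_^-1 *: _]/(_ * _) mulrA divff ?mul1r// gt_eqF.
by rewrite normrM gtr0_norm// mulrC ler_wpM2r// ltW.
Qed.

Lemma le_dot_grad f x d c : differentiable f x ->
  (forall a, 0 < a <= 1 -> a * c <= f (x + a *: d) - f x) ->
  c <= dot (grad f x) d.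
Proof.
move=> fx h; rewrite leNgt; apply/negP => lt.
have e0 : 0 < (c - dot (grad f x) d) / 2 by rewrite divr_gt0// subr_gt0.
have [a [a0 a1 _]] := grad_approx d fx e0.
rewrite ler_norml => /andP[_ hi]; have := h a; rewrite a0 a1 => /(_ isT) hc.
have : a * c <= a * (dot (grad f x) d + (c - dot (grad f x) d) / 2).
  by move: hi hc; lra.
rewrite ler_pM2l//; lra.
Qed.

(** The remainder [a ^+ 2 * q] leaves room for the quadratic correction in the
    chord inequality of a strongly convex function. *)
Lemma dot_grad_le f x d c q : differentiable f x -> 0 <= q ->
  (forall a, 0 < a <= 1 -> f (x + a *: d) - f x <= a * c + a ^+ 2 * q) ->
  dot (grad f x) d <= c.
Proof.
move=> fx q0 h; rewrite leNgt; apply/negP => lt.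
pose e := (dot (grad f x) d - c) / (2 * (1 + q)).
have q1 : 0 < 1 + q by lra.
have e0 : 0 < e by rewrite divr_gt0 ?mulr_gt0// subr_gt0.
have eE : e * (1 + q) = (dot (grad f x) d - c) / 2.
  by rewrite /e; field; lra.
have [a [a0 a1 ae]] := grad_approx d fx e0.
rewrite ler_norml => /andP[hi _]; have := h a; rewrite a0 a1 => /(_ isT) hc.
have : a * (dot (grad f x) d - e * (1 + q)) <= a * c.
  have : a * a * q <= a * e * q by rewrite ler_wpM2r// ler_wpM2l// ltW.
  by move: hi hc; rewrite expr2; nra.
rewrite ler_pM2l// eE; lra.
Qed.

Lemma conv_segment x y (a : R) : a *: y + (1 - a) *: x = x + a *: (y - x).
Proof. by rewrite scalerBl scale1r scalerBr addrC addrAC addrA. Qed.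

Lemma convex_grad_le f x y : convex_function setT f -> differentiable f x ->
  dot (grad f x) (y - x) <= f y - f x.
Proof.
move=> cf fx; apply: (@dot_grad_le f x (y - x) _ 0) => // a /andP[a0 a1].
have := @convex_function_conv setT f y x a cf I I.
rewrite conv_segment (ltW a0) a1 => /(_ isT); lra.
Qed.

End convexity.

Section smoothness.
Context {R : realType} {n : nat} {nrm : 'rV[R]_n -> R}.
Hypothesis Hn : is_norm nrm.
Variables (Z : set 'rV[R]_n) (G : 'rV[R]_n -> R) (L : R).
Hypotheses (cZ : convex_set Z) (cG : convex_function setT G)
  (dG : forall x, differentiable G x) (L0 : 0 < L)
  (lG : lipschitz_dual nrm Z (grad G) L).

Lemma lip_dot w v d : Z w -> Z v ->
  dot (grad G w - grad G v) d <= L * nrm (w - v) * nrm d.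
Proof.
move=> Zw Zv; apply: (le_trans (ler_dot_dual Hn _ _)).
by rewrite ler_wpM2r ?nrm_ge0//; exact: lG.
Qed.

(** The constant [c] of a quadratic upper bound improves to [c / 2 + L / 4] when
    the bound is applied on both halves of a segment, and convexity provides the
    initial value [c = L]. *)
Let descent_approx m x y : Z x -> Z y ->
  G y - G x - dot (grad G x) (y - x) <= (L / 2 + L / 2 / 2 ^+ m) * nrm (y - x) ^+ 2.
Proof.
elim: m x y => [|m IH] x y Zx Zy.
  have h1 := convex_grad_le x cG (dG y).
  have h2 := lip_dot (y - x) Zy Zx; rewrite dotBl in h2.
  rewrite expr0 divr1 -splitr expr2 mulrA.
  rewrite -opprB dotNr in h1; move: h1 h2; lra.
pose h := 2^-1 *: y + (1 - 2^-1) *: x.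
have Zh : Z h by apply: convex_set_conv => //; lra.
have hx : h - x = 2^-1 *: (y - x).
  by rewrite /h conv_segment addrC addKr.
have yh : y - h = 2^-1 *: (y - x).
  have -> : y - h = (y - x) - (h - x) by rewrite opprB addrA subrK.
  by rewrite hx -{1}[y - x]scale1r -scalerBl; congr (_ *: _); lra.
have i1 := IH x h Zx Zh; have i2 := IH h y Zh Zy.
have i3 := lip_dot (y - h) Zh Zx; rewrite dotBl in i3.
have e2 : `|2^-1 : R| = 2^-1 by rewrite ger0_norm.
rewrite ?yh ?hx !dotZr !(norm_homogeneous Hn) e2 in i1 i2 i3.
have -> : (2 : R) ^+ m.+1 = 2 * 2 ^+ m by rewrite exprS.
have -> : L / 2 / (2 * 2 ^+ m) = (L / 2 / 2 ^+ m) / 2.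
  by field; rewrite expf_neq0.
move: i1 i2 i3; set c := L / 2 / 2 ^+ m; set N := nrm _; set D := dot _ _.
set D' := dot _ _; rewrite !expr2; nra.
Qed.

Lemma descent x y : Z x -> Z y ->
  G y - G x - dot (grad G x) (y - x) <= L / 2 * nrm (y - x) ^+ 2.
Proof.
move=> Zx Zy; set lhs := (X in X <= _); set Q := nrm _ ^+ 2.
have Q0 : 0 <= Q by rewrite /Q exprn_ge0// nrm_ge0.
rewrite leNgt; apply/negP => lt.
have [m hm] : exists m, L / 2 * Q / (lhs - L / 2 * Q) < 2 ^+ m.
  set w := L / 2 * Q / _; exists (Num.bound w).
  apply: lt_le_trans (_ : (Num.bound w)%:R <= _).
    apply: archi_boundP; rewrite /w divr_ge0 ?subr_ge0 ?(ltW lt)// mulr_ge0//.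
    by rewrite divr_ge0// ltW.
  by rewrite -natrX ler_nat; apply/ltnW/ltn_expl.
have p2 : (0 : R) < 2 ^+ m by rewrite exprn_gt0.
have := descent_approx m Zx Zy; rewrite -/lhs -/Q.
rewrite ltr_pdivrMr ?subr_gt0// in hm.
have : L / 2 / 2 ^+ m * Q < lhs - L / 2 * Q.
  by rewrite mulrAC ltr_pdivrMr// [X in _ < X]mulrC.
lra.
Qed.

End smoothness.

Section prox.
Context {R : realType} {n : nat} {nrm : 'rV[R]_n -> R}.
Hypothesis Hn : is_norm nrm.
Variables (Z : set 'rV[R]_n) (J pi : 'rV[R]_n -> R).
Hypotheses (cZ : convex_set Z) (cJ : convex_function Z J)
  (pp : prox_function nrm Z pi).

Lemma prox_differentiable z : Z z -> differentiable pi z.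
Proof. by case: pp => -[U [_ ZU cd]] _ /ZU/cd[]. Qed.

(** The chord inequality of strong convexity, divided by the step, gives this
    bound in the limit of a vanishing step. *)
Lemma bregman_ge z u : Z z -> Z u -> 2^-1 * nrm (u - z) ^+ 2 <= bregman pi z u.
Proof.
move=> Zz Zu; rewrite /bregman lerBrDl -lerBrDr.
apply: (@dot_grad_le _ _ _ _ _ _ (2^-1 * nrm (u - z) ^+ 2)).
- exact: prox_differentiable.
- by rewrite mulr_ge0// exprn_ge0// nrm_ge0.
move=> a /andP[a0 a1]; have := proj2 pp u z a Zu Zz; rewrite conv_segment.
rewrite (ltW a0) a1 => /(_ isT); set N := nrm _ ^+ 2; rewrite expr2; lra.
Qed.

Lemma bregman_ge0 z u : Z z -> Z u -> 0 <= bregman pi z u.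
Proof.
move=> Zz Zu; apply: le_trans (bregman_ge Zz Zu).
by rewrite mulr_ge0// exprn_ge0// nrm_ge0.
Qed.

Lemma convex_bregman u : convex_function Z (bregman pi u).
Proof.
move=> t x y; rewrite !inE => Zx Zy.
have a01 : 0 <= t%:num <= 1 by rewrite ge0 le1.
have := proj2 pp x y t%:num Zx Zy a01.
change (pi (t%:num *: x + (1 - t%:num) *: y) <= t%:num * pi x + (1 - t%:num) * pi y
   - 2^-1 * t%:num * (1 - t%:num) * nrm (x - y) ^+ 2 ->
  bregman pi u (t%:num *: x + (1 - t%:num) *: y) <=
  t%:num * bregman pi u x + (1 - t%:num) * bregman pi u y).
move: a01; set a := t%:num => /andP[a0 a1] h.
have q : 0 <= 2^-1 * a * (1 - a) * nrm (x - y) ^+ 2.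
  by rewrite !mulr_ge0 ?exprn_ge0 ?nrm_ge0 ?subr_ge0.
rewrite /bregman !dotE; lra.
Qed.

(** First-order optimality: the derivative of the subproblem from its minimizer
    towards any feasible point is nonnegative, [J] being bounded by its chord. *)
Lemma argmin_subproblem_vi (xi u v z y : 'rV[R]_n) (b eta : R) :
  0 < b + eta -> argmin Z (subproblem J pi xi b eta u v) z -> Z y ->
  dot (b *: grad pi u + eta *: grad pi v - xi) (y - z) + J z - J y <=
    (b + eta) * dot (grad pi z) (y - z).
Proof.
move=> be0 [Zz zmin] Zy; rewrite mulrC -ler_pdivrMr//.
apply: le_dot_grad => //; first exact: prox_differentiable.
move=> a /andP[a0 a1]; rewrite mulrA ler_pdivrMr//.
have a01 : 0 <= a <= 1 by rewrite ltW.
have Za := convex_set_conv cZ Zy Zz a01.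
have Ja := convex_function_conv cJ Zy Zz a01.
have := zmin _ Za; rewrite conv_segment in Ja *.
have sh (g w : 'rV[R]_n) :
    dot g (z + a *: (y - z) - w) = dot g (z - w) + a * dot g (y - z).
  by rewrite -dotZr -dotDr addrAC.
rewrite /subproblem /bregman !sh (dotDr z (a *: _)) dotZr dotBl dotDl !dotZl.
move: Ja; lra.
Qed.

(** Expanding the Bregman distances turns the optimality condition into an
    inequality free of gradients, in which the distances to [y] can telescope. *)
Lemma three_point (xi u v z y : 'rV[R]_n) (b eta : R) :
  0 < b + eta -> argmin Z (subproblem J pi xi b eta u v) z -> Z y ->
  dot xi (z - y) + J z - J y + b * bregman pi u z + eta * bregman pi v z
    + (b + eta) * bregman pi z y <= b * bregman pi u y + eta * bregman pi v y.
Proof.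
move=> be0 zmin Zy; have := argmin_subproblem_vi be0 zmin Zy.
rewrite /bregman !dotE; lra.
Qed.

(** A subproblem sees its centres only through [xi - b *: grad pi u - eta *: grad
    pi v], and its objective is strongly convex with modulus [b + eta]. *)
Lemma argmin_lipschitz (xi xi' u v u' v' z z' : 'rV[R]_n) (b eta : R) :
  0 < b + eta ->
  argmin Z (subproblem J pi xi b eta u v) z ->
  argmin Z (subproblem J pi xi' b eta u' v') z' ->
  (b + eta) * nrm (z - z') <=
    dual_norm nrm ((xi - b *: grad pi u - eta *: grad pi v)
                 - (xi' - b *: grad pi u' - eta *: grad pi v')).
Proof.
move=> be0 zm zm'; have [Zz _] := zm; have [Zz' _] := zm'.
have v1 := argmin_subproblem_vi be0 zm Zz'.
have v2 := argmin_subproblem_vi be0 zm' Zz.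
have g1 := bregman_ge Zz Zz'; have g2 := bregman_ge Zz' Zz.
set D := (X in dual_norm _ X); have := ler_dot_dual Hn D (z' - z).
have [->|zz'] := eqVneq z z'.
  by move=> _; rewrite subrr (nrm0 Hn) mulr0; exact: (dual_norm_ge0 Hn).
rewrite (nrm_distC Hn z') => h.
have nz : 0 < nrm (z - z').
  rewrite lt_neqAle nrm_ge0// andbT eq_sym; apply: contra_neq zz' => /(norm_definite Hn).
  by move/eqP; rewrite subr_eq0 => /eqP.
rewrite -(ler_pM2r nz) -mulrA -expr2; apply: le_trans h.
rewrite (nrm_distC Hn z') in g1.
have : nrm (z - z') ^+ 2 <= dot (grad pi z - grad pi z') (z - z').
  by move: g1 g2; rewrite /bregman dotBl -(opprB z z') dotNr; lra.
move/(ler_wpM2l (ltW be0)) => g; apply: (le_trans g).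
have DE : D = (b *: grad pi u' + eta *: grad pi v' - xi')
    - (b *: grad pi u + eta *: grad pi v - xi).
  have oppA (w a c : 'rV[R]_n) : - (a + c - w) = w - a - c.
    by rewrite opprB opprD addrA.
  by rewrite oppA addrC -[X in _ + X]opprK oppA.
rewrite DE -(opprB z z') !dotNr (dotBl (grad pi z)).
rewrite (dotBl (_ - xi')); move: v1 v2; rewrite -(opprB z z') !dotNr; lra.
Qed.

End prox.

(** * The pathwise bound on the gap *)

(** Young's inequality for the product with [b] costs [(M a + d1 + d2)^2 / (2 s)];
    of its expansion bounded by three squares, the term in [a] is at most
    [eta / 2 * a ^+ 2] by the hypothesis. *)
Lemma noise_young (R : realType) (M a b d1 d2 eta s : R) :
  0 < s -> 3 * M ^+ 2 <= eta * s ->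
  (M * a + d1 + d2) * b - eta / 2 * a ^+ 2 - s / 2 * b ^+ 2 <=
    3 * (d1 ^+ 2 + d2 ^+ 2) / (2 * s).
Proof.
move=> s0 h; rewrite ler_pdivlMr ?mulr_gt0//.
set x := M * a.
have h1 : 3 * x ^+ 2 <= eta * s * a ^+ 2.
  by rewrite /x exprMn mulrA ler_wpM2r// sqr_ge0.
have h2 := sqr_ge0 (x + d1 + d2 - s * b).
have h3 := sqr_ge0 (x - d1); have h4 := sqr_ge0 (x - d2).
have h5 := sqr_ge0 (d1 - d2).
move: h1 h2 h3 h4 h5; rewrite !expr2; lra.
Qed.

Section feasibility.
Context {R : realType} {n : nat}.
Variables (Z : set 'rV[R]_n) (G J pi : 'rV[R]_n -> R).
Hypotheses (cZ : convex_set Z) (cJ : convex_function Z J).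
Context {X : Type} (Hs : 'rV[R]_n -> X -> 'rV[R]_n).
Variables (z0 : 'rV[R]_n) (N : nat) (p : smps_params R)
  (zeta : nat -> nat -> X) (it : smps_iterates R n).
Hypotheses (Zz0 : Z z0) (run : smps_run Z G J pi Hs z0 N p zeta it).
Hypothesis T_gt0 : forall k, (1 <= k <= N)%N -> (0 < T_ p k)%N.
Hypothesis gamma01 : forall k, (1 <= k <= N)%N -> 0 <= gamma_ p k <= 1.

Let run_k := let: And3 _ _ h := run in h.

Lemma z_in_pos_mem k t : (1 <= k <= N)%N -> (1 <= t <= T_ p k)%N -> Z (z_in it k t).
Proof. by move=> kN tT; have [_ /(_ _ tT)[_ []]] := run_k kN. Qed.

Lemma z_tilde_in_mem k t : (1 <= k <= N)%N -> (1 <= t <= T_ p k)%N ->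
  Z (z_tilde_in it k t).
Proof. by move=> kN tT; have [_ /(_ _ tT)[[]]] := run_k kN. Qed.

Lemma z_out_mem k : (k <= N)%N -> Z (z_out it k).
Proof.
case: k => [_|k kN]; first by have [-> _ _] := run.
have k1 : (1 <= k.+1 <= N)%N by rewrite kN.
by have [_ _ -> _ _] := run_k k1; apply: z_in_pos_mem; rewrite ?T_gt0 ?leqnn.
Qed.

Lemma z_in_mem k t : (1 <= k <= N)%N -> (t <= T_ p k)%N -> Z (z_in it k t).
Proof.
move=> kN; case: t => [_|t tT]; last exact: z_in_pos_mem.
have [[_ ->] _ _ _ _] := run_k kN; apply: z_out_mem; lia.
Qed.

Lemma z_tilde_mem k : (1 <= k <= N)%N -> Z (z_tilde it k).
Proof.
move=> kN; have [_ _ _ -> _] := run_k kN.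
apply: (proj1 (convex_mean cZ cJ (T_gt0 kN) _)) => t tT; exact: z_tilde_in_mem.
Qed.

Lemma z_bar_mem k : (k <= N)%N -> Z (z_bar it k).
Proof.
elim: k => [_|k IH kN]; first by have [_ -> _] := run.
have k1 : (1 <= k.+1 <= N)%N by rewrite kN.
have [_ _ _ _ ->] := run_k k1.
have /andP[g0 g1] := gamma01 k1.
rewrite addrC -{2}(subKr 1 (gamma_ p k.+1)) opprB addrCA subrr addr0.
apply: convex_set_conv => //; [exact: z_tilde_mem|exact/IH/ltnW|].
by rewrite g0.
Qed.

Lemma z_under_mem k : (1 <= k <= N)%N -> Z (z_under it k).
Proof.
move=> k1; have [[-> _] _ _ _ _] := run_k k1.
rewrite addrC; apply: convex_set_conv => //; last exact: gamma01.
- by apply: z_out_mem; lia.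
- by apply: z_bar_mem; lia.
Qed.

End feasibility.

Section deterministic_bound.
Context {R : realType} {n : nat} {nrm : 'rV[R]_n -> R}.
Hypothesis Hn : is_norm nrm.
Variables (Z : set 'rV[R]_n) (G J pi : 'rV[R]_n -> R) (H : 'rV[R]_n -> 'rV[R]_n).
Variables (L M : R).
Hypotheses (cZ : convex_set Z) (cG : convex_function setT G)
  (dG : forall x, differentiable G x) (mH : monotone_operator H)
  (L0 : 0 < L) (M0 : 0 < M)
  (lG : lipschitz_dual nrm Z (grad G) L) (lH : lipschitz_dual nrm Z H M)
  (pp : prox_function nrm Z pi) (cJ : convex_function Z J).

(** What the sampling errors leave of one inner step: a variance term and an inner
    product that has mean zero when the sample at [zt] is drawn after [zt]. *)
Definition step_noise (s : R) (z v zt h1 h2 : 'rV[R]_n) : R :=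
  3 * (dual_norm nrm (h1 - H v) ^+ 2 + dual_norm nrm (h2 - H zt) ^+ 2) / (2 * s)
  - dot (h2 - H zt) (zt - z).

(** The extragradient estimate.  The optimality of [zn] is tested at [z] and that
    of [zt] at [zn]; the mismatch between the two sampled operators, paired with
    [zt - zn], is controlled by the Lipschitz bound and [noise_young]. *)
Lemma inner_step (g h1 h2 u v zt zn z : 'rV[R]_n) (b eta : R) :
  0 < b + eta -> 3 * M ^+ 2 <= eta * (b + eta) -> 0 <= eta ->
  Z u -> Z v -> Z z ->
  argmin Z (subproblem J pi (g + h1) b eta u v) zt ->
  argmin Z (subproblem J pi (g + h2) b eta u v) zn ->
  dot g (zt - z) + dot (H z) (zt - z) + J zt - J z + b * bregman pi u zt <=
    b * bregman pi u z + eta * bregman pi v z - (b + eta) * bregman pi zn z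
    + step_noise (b + eta) z v zt h1 h2.
Proof.
move=> s0 hM e0 Zu Zv Zz mt mn.
have [Zt _] := mt; have [Zn _] := mn.
have t1 := three_point cZ cJ pp s0 mn Zz.
have t2 := three_point cZ cJ pp s0 mt Zn.
have mo := mH zt z; rewrite dotBl in mo.
pose a := nrm (zt - v); pose d := nrm (zt - zn).
have b1 : eta / 2 * a ^+ 2 <= eta * bregman pi v zt.
  by rewrite -mulrA; apply: ler_wpM2l => //; exact: (bregman_ge Hn pp).
have b2 : (b + eta) / 2 * d ^+ 2 <= (b + eta) * bregman pi zt zn.
  rewrite -mulrA /d (nrm_distC Hn); apply: ler_wpM2l; first exact: ltW.
  exact: (bregman_ge Hn pp).
have l0 : dot (H zt - H v) (zt - zn) <= M * a * d.
  apply: (le_trans (ler_dot_dual Hn _ _)).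
  by rewrite ler_wpM2r ?nrm_ge0// /a; exact: lH.
have l1 : dot (h2 - H zt) (zt - zn) <= dual_norm nrm (h2 - H zt) * d.
  exact: (ler_dot_dual Hn).
have l2 : - dot (h1 - H v) (zt - zn) <= dual_norm nrm (h1 - H v) * d.
  by rewrite -dotNl -(dual_normN Hn) (ler_dot_dual Hn).
rewrite /step_noise; set Y := 3 * _ / _.
have hY : (M * a + dual_norm nrm (h1 - H v) + dual_norm nrm (h2 - H zt)) * d
    - eta / 2 * a ^+ 2 - (b + eta) / 2 * d ^+ 2 <= Y by exact: noise_young.
have split2 : dot h2 (zn - z) = dot h2 (zt - z) - dot h2 (zt - zn).
  by rewrite !dotBr; ring.
have split1 : dot g (zn - z) + dot g (zt - zn) = dot g (zt - z).
  by rewrite !dotBr; ring.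
rewrite dotDl in t1; rewrite dotDl in t2.
rewrite !dotBl in l0 l1 l2 *.
move: t1 t2 mo b1 b2 l0 l1 l2 hY; rewrite split2 -split1.
lra.
Qed.

Section run.
Context {X : Type} (Hs : 'rV[R]_n -> X -> 'rV[R]_n).
Variables (z0 : 'rV[R]_n) (N : nat) (p : smps_params R)
  (zeta : nat -> nat -> X) (it : smps_iterates R n).
Hypotheses (Zz0 : Z z0) (run : smps_run Z G J pi Hs z0 N p zeta it).
Hypothesis T_gt0 : forall k, (1 <= k <= N)%N -> (0 < T_ p k)%N.
Hypothesis gamma01 : forall k, (1 <= k <= N)%N -> 0 <= gamma_ p k <= 1.

Let run_k := let: And3 _ _ h := run in h.

Definition noise z k t :=
  step_noise (beta_ p k + eta_ p k t) z (z_in it k t.-1) (z_tilde_in it k t)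
    (Hs (z_in it k t.-1) (zeta k (2 * t).-1)) (Hs (z_tilde_in it k t) (zeta k (2 * t)%N)).

(** Monotonicity replaces [H] at the moving points by [H z], and the smoothness
    error of [G] is absorbed by the prox term centred at [z_out it k.-1]. *)
Lemma outer_step k z : (1 <= k <= N)%N -> Z z ->
  0 <= beta_ p k -> L * gamma_ p k <= beta_ p k ->
  (forall t, (1 <= t <= T_ p k)%N ->
     [/\ 0 <= eta_ p k t, 0 < beta_ p k + eta_ p k t,
         3 * M ^+ 2 <= eta_ p k t * (beta_ p k + eta_ p k t) &
         eta_ p k t.+1 = beta_ p k + eta_ p k t]) ->
  gap G H J (z_bar it k) z <= (1 - gamma_ p k) * gap G H J (z_bar it k.-1) z
    + gamma_ p k / (T_ p k)%:R *
      (((T_ p k)%:R * beta_ p k + eta_ p k 1) * bregman pi (z_out it k.-1) z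
       - eta_ p k (T_ p k).+1 * bregman pi (z_out it k) z
       + \sum_(1 <= t < (T_ p k).+1) noise z k t).
Proof.
move=> kN Zz b0 Lg par.
have [[unE in0] steps outE tiE barE] := run_k kN.
set T := T_ p k in par *; have T0 : (0 < T)%N by exact: T_gt0.
have TR : 0 < (T%:R : R) by rewrite ltr0n.
set gam := gamma_ p k; set b := beta_ p k in b0 Lg par *.
set eta := eta_ p k in par *; set u := z_out it k.-1.
set zu := z_under it k; set zt := z_tilde it k.
set bar := z_bar it k.-1; set bar' := z_bar it k.
have Zu : Z u by apply: (z_out_mem Zz0 run T_gt0); lia.
have Zbar : Z bar by apply: (z_bar_mem cZ cJ Zz0 run T_gt0 gamma01); lia.
have Zbar' : Z bar' by apply: (z_bar_mem cZ cJ Zz0 run T_gt0 gamma01); lia.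
have Zun : Z zu by exact: (z_under_mem cZ cJ Zz0 run T_gt0 gamma01).
have Zti t : (1 <= t < T.+1)%N -> Z (z_tilde_in it k t).
  by move=> tT; exact: (z_tilde_in_mem run kN tT).
have [Zt Jt] := convex_mean cZ cJ T0 Zti; rewrite -tiE -/zt in Zt Jt.
have g01 := gamma01 kN; have [g0 g1] := andP g01.
rewrite -/gam in g01 g0 g1 Lg.
(* The distances telescope as [eta t.+1 = b + eta t]. *)
have inner : \sum_(1 <= t < T.+1)
    (dot (grad G zu) (z_tilde_in it k t - z) + dot (H z) (z_tilde_in it k t - z)
     + J (z_tilde_in it k t) - J z + b * bregman pi u (z_tilde_in it k t)) <=
    (T%:R * b + eta 1%N) * bregman pi u z - eta T.+1 * bregman pi (z_out it k) z
    + \sum_(1 <= t < T.+1) noise z k t.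
  have in_le m : (m <= T)%N -> \sum_(1 <= t < m.+1)
      (dot (grad G zu) (z_tilde_in it k t - z) + dot (H z) (z_tilde_in it k t - z)
       + J (z_tilde_in it k t) - J z + b * bregman pi u (z_tilde_in it k t)) <=
      (m%:R * b + eta 1%N) * bregman pi u z - eta m.+1 * bregman pi (z_in it k m) z
      + \sum_(1 <= t < m.+1) noise z k t.
    elim: m => [_|m IH mT]; first by rewrite !big_geq// in0 mul0r add0r subrr addr0.
    rewrite !(big_nat_recr m.+1)//=; have {}IH := IH (ltnW mT).
    have m1 : (1 <= m.+1 <= T)%N by rewrite mT.
    have [e0 s0 hM ->] := par _ m1; have [mt mn] := steps _ m1.
    have Zv : Z (z_in it k m) by apply: (z_in_mem Zz0 run T_gt0) => //; exact: ltnW.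
    have := inner_step s0 hM e0 Zu Zv Zz mt mn.
    rewrite -natr1 /noise /=; move: IH; lra.
  by rewrite outE; exact: in_le.
pose c := dot (grad G zu) (zt - z) + dot (H z) (zt - z) + J zt - J z + b * bregman pi u zt.
have cV : convex_function Z (bregman pi u) := convex_bregman Hn pp u.
have [_ Vt] := convex_mean cZ cV T0 Zti; rewrite -tiE -/zt in Vt.
have mean_dot (w : 'rV[R]_n) : dot w (zt - z) =
    T%:R^-1 * \sum_(1 <= t < T.+1) dot w (z_tilde_in it k t - z).
  rewrite dotBr /zt tiE dotZr dot_sumr.
  under [in RHS]eq_bigr do rewrite dotBr.
  rewrite big_split/= mulrDr sumr_const_nat subn1/= mulNrn -[dot w z *+ T]mulr_natl mulrN mulrA.
  by rewrite mulVf ?mul1r// gt_eqF.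
have c_le : c <= T%:R^-1 * ((T%:R * b + eta 1%N) * bregman pi u z
    - eta T.+1 * bregman pi (z_out it k) z + \sum_(1 <= t < T.+1) noise z k t).
  apply: le_trans (ler_wpM2l _ inner); last by rewrite invr_ge0 ltW.
  rewrite !big_split/= -mulr_sumr !mulrDr -!mean_dot sumr_const_nat subn1/=.
  have -> : T%:R^-1 * ((- J z) *+ T) = - J z.
    by rewrite -[(- J z) *+ T]mulr_natl mulrA mulVf ?mul1r// gt_eqF.
  have := ler_wpM2l b0 Vt; rewrite /c; move: Jt; lra.
have barE' : bar' = (1 - gam) *: bar + gam *: zt by exact: barE.
have zuE : zu = (1 - gam) *: bar + gam *: u by exact: unE.
have dif : bar' - zu = gam *: (zt - u).
  by rewrite barE' zuE opprD addrACA subrr add0r -scalerBr.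
have ds := descent Hn cZ cG dG L0 lG Zun Zbar'.
rewrite dif dotZr (norm_homogeneous Hn) ger0_norm// in ds.
have c1 := convex_grad_le bar cG (dG zu); have c2 := convex_grad_le z cG (dG zu).
have Jb : J bar' <= (1 - gam) * J bar + gam * J zt.
  rewrite barE' [(1 - gam) *: bar + _]addrC [(1 - gam) * J bar + _]addrC.
  exact: convex_function_conv.
have V1 := bregman_ge Hn pp Zu Zt.
have V0 := bregman_ge0 Hn pp Zu Zt.
have q : L / 2 * (gam * nrm (zt - u)) ^+ 2 <= gam * (b * bregman pi u zt).
  have -> : L / 2 * (gam * nrm (zt - u)) ^+ 2 =
    gam * ((L * gam) * (2^-1 * nrm (zt - u) ^+ 2)) by field.
  apply: ler_wpM2l => //; apply: (le_trans (ler_wpM2l _ V1)).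
    by rewrite mulr_ge0// ltW.
  exact: ler_wpM2r.
have gc := ler_wpM2l g0 c_le; rewrite mulrA in gc.
apply: le_trans (lerD (lexx _) gc).
have e1 : dot (grad G zu) (gam *: (zt - u)) =
    (1 - gam) * dot (grad G zu) (bar - zu) + gam * dot (grad G zu) (zt - zu).
  rewrite -!dotZr -dotDr -dif barE'; congr dot.
  by rewrite !scalerBr addrACA -opprD -scalerDl subrK scale1r.
have e2 : dot (H z) (bar' - z) =
    (1 - gam) * dot (H z) (bar - z) + gam * dot (H z) (zt - z).
  rewrite -!dotZr -dotDr barE'; congr dot.
  by rewrite !scalerBr addrACA -opprD -scalerDl subrK scale1r.
rewrite dotZr in e1.
have c1' : (1 - gam) * dot (grad G zu) (bar - zu) <= (1 - gam) * (G bar - G zu).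
  by apply: ler_wpM2l => //; lra.
have c2' : gam * dot (grad G zu) (z - zu) <= gam * (G z - G zu) by exact: ler_wpM2l.
rewrite /gap e2 /c.
have e3 : dot (grad G zu) (zt - zu) = dot (grad G zu) (zt - z) + dot (grad G zu) (z - zu).
  by rewrite -dotDr addrA subrK.
rewrite e3 in e1; move: ds c1' c2' Jb q e1.
lra.
Qed.

End run.
End deterministic_bound.

Section sliding_parameters.
Context {R : realType}.
Variables (L M sigma Om : R).
Hypotheses (L0 : 0 < L) (M0 : 0 < M) (Om0 : 0 < Om).

Definition steps_real (N k : nat) : R :=
  Num.sqrt 3 * k%:R * M / L + N%:R * k%:R ^+ 2 * sigma ^+ 2 / (Om * L ^+ 2).

Let steps_variance_ge0 N k :
  0 <= N%:R * k%:R ^+ 2 * sigma ^+ 2 / (Om * L ^+ 2).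
Proof.
by rewrite divr_ge0 ?(mulr_ge0 (mulr_ge0 _ (sqr_ge0 _)) (sqr_ge0 _))
  ?(mulr_ge0 (ltW Om0) (sqr_ge0 L)).
Qed.

Lemma steps_real_gt0 N k : (0 < k)%N -> 0 < steps_real N k.
Proof.
move=> k0; rewrite ltr_wpDr//.
by rewrite divr_gt0// !mulr_gt0 ?sqrtr_gt0 ?ltr0n.
Qed.

Lemma inner_steps_bounds N k : (0 < k)%N ->
  steps_real N k <= (inner_steps L M sigma Om N k)%:R < steps_real N k + 1.
Proof.
move=> k0; have s0 := steps_real_gt0 N k0.
rewrite /inner_steps -/(steps_real N k).
have c0 : (0 <= Num.ceil (steps_real N k))%R by rewrite ltW// -[0]/(0%:Z) ceil_gt0.
rewrite natr_absz ger0_norm// ceil_ge/= -ltrBlDr.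
by have := ceilB1_lt (steps_real N k); rewrite rmorphB.
Qed.

Lemma inner_steps_gt0 N k : (0 < k)%N -> (0 < inner_steps L M sigma Om N k)%N.
Proof.
move=> k0; rewrite -(ltr0n R).
by have /andP[+ _] := inner_steps_bounds N k0; apply: lt_le_trans (steps_real_gt0 N k0).
Qed.

Let p N := sliding_params L M sigma Om N.

Lemma sliding_etaS N k t : eta_ (p N) k t.+1 = beta_ (p N) k + eta_ (p N) k t.
Proof. by rewrite /= -natr1; ring. Qed.

Lemma sliding_eta_ge N k t : (0 < k)%N -> (0 < t)%N ->
  L * (T_ (p N) k)%:R / k%:R <= eta_ (p N) k t.
Proof.
move=> k0 t0 /=; rewrite lerDr mulr_ge0 ?divr_ge0 ?mulr_ge0//; first exact: ltW.
by rewrite subr_ge0 ler1n.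
Qed.

(** The summand of [inner_steps] with [M] serves this bound, which implies the
    step-size condition of [inner_step]. *)
Lemma sliding_eta_geM N k t : (0 < k)%N -> (0 < t)%N ->
  Num.sqrt 3 * M <= eta_ (p N) k t.
Proof.
move=> k0 t0; apply: le_trans (sliding_eta_ge N k0 t0).
have /andP[+ _] := inner_steps_bounds N k0; rewrite /steps_real /= => h.
have kR : 0 < (k%:R : R) by rewrite ltr0n.
rewrite ler_pdivlMr// mulrC.
have h2 : Num.sqrt 3 * k%:R * M / L <= (inner_steps L M sigma Om N k)%:R.
  apply: le_trans h; rewrite lerDl; exact: steps_variance_ge0.
rewrite ler_pdivrMr// in h2; move: h2; rewrite [L * _]mulrC; lra.
Qed.

End sliding_parameters.

Section sliding_bound.
Context {R : realType} {n : nat} {nrm : 'rV[R]_n -> R}.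
Hypothesis Hn : is_norm nrm.
Variables (Z : set 'rV[R]_n) (G J pi : 'rV[R]_n -> R) (H : 'rV[R]_n -> 'rV[R]_n).
Variables (L M sigma Om : R).
Hypotheses (cZ : convex_set Z) (cG : convex_function setT G)
  (dG : forall x, differentiable G x) (mH : monotone_operator H)
  (L0 : 0 < L) (M0 : 0 < M) (Om0 : 0 < Om)
  (lG : lipschitz_dual nrm Z (grad G) L) (lH : lipschitz_dual nrm Z H M)
  (pp : prox_function nrm Z pi) (cJ : convex_function Z J).
Context {X : Type} (Hs : 'rV[R]_n -> X -> 'rV[R]_n).
Variables (z0 : 'rV[R]_n) (N : nat)
  (zeta : nat -> nat -> X) (it : smps_iterates R n).
Let p := sliding_params L M sigma Om N.
Hypotheses (Zz0 : Z z0) (run : smps_run Z G J pi Hs z0 N p zeta it).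

Lemma sliding_T_gt0 k : (1 <= k <= N)%N -> (0 < T_ p k)%N.
Proof. by move=> /andP[k0 _]; exact: inner_steps_gt0. Qed.

Lemma sliding_gamma01 k : (1 <= k <= N)%N -> 0 <= gamma_ p k <= 1.
Proof.
by move=> /andP[k0 _] /=; rewrite divr_ge0//= ler_pdivrMr// mul1r ler_nat.
Qed.

(** With the weights [k * k.+1] the recursion of [outer_step] telescopes, both in
    the gaps and in the distances, whose coefficients [6 * L] do not depend on
    [k]. *)
Lemma sliding_gap_bound z : Z z ->
  N%:R * N.+1%:R * gap G H J (z_bar it N) z <=
    6 * L * bregman pi z0 z + \sum_(1 <= k < N.+1) 2 * k%:R / (T_ p k)%:R *
      \sum_(1 <= t < (T_ p k).+1) noise (nrm := nrm) H Hs p zeta it z k t.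
Proof.
move=> Zz.
suff h K : (K <= N)%N -> K%:R * K.+1%:R * gap G H J (z_bar it K) z <=
    6 * L * (bregman pi z0 z - bregman pi (z_out it K) z) +
    \sum_(1 <= k < K.+1) 2 * k%:R / (T_ p k)%:R *
      \sum_(1 <= t < (T_ p k).+1) noise (nrm := nrm) H Hs p zeta it z k t.
  apply: (le_trans (h N (leqnn _))); rewrite lerD2r ler_wpM2l//.
    by rewrite mulr_ge0// ltW.
  rewrite lerBlDr lerDl; apply: (bregman_ge0 Hn pp) => //.
  exact: (z_out_mem Zz0 run sliding_T_gt0).
elim: K => [_|K IH KN].
  have [-> _ _] := run.
  by rewrite big_geq// !mul0r subrr mulr0 addr0.
have k1 : (1 <= K.+1 <= N)%N by rewrite KN.
rewrite (big_nat_recr K.+1)//=; have {}IH := IH (ltnW KN).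
have KR : 0 < (K.+1%:R : R) by rewrite ltr0n.
have KR2 : 0 < (K.+2%:R : R) by rewrite ltr0n.
have K2 : (K.+2%:R : R) = K.+1%:R + 1 by rewrite -natr1.
have TR : 0 < ((T_ p K.+1)%:R : R) by rewrite ltr0n sliding_T_gt0.
have b0 : 0 <= beta_ p K.+1 by rewrite /= divr_ge0// mulr_ge0// ltW.
have Lg : L * gamma_ p K.+1 <= beta_ p K.+1.
  rewrite /= mulrA [L * 2]mulrC ler_wpM2l ?mulr_ge0 ?(ltW L0)//.
  by rewrite lef_pV2 ?posrE// ler_nat.
have := outer_step Hn cZ cG dG mH L0 M0 lG lH pp cJ Zz0 run sliding_T_gt0
  sliding_gamma01 k1 Zz b0 Lg.
move=> /(_ _)/wrap[t /andP[t0 tT]|].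
  have e1 : Num.sqrt 3 * M <= eta_ p K.+1 t by exact: sliding_eta_geM.
  have sM : 0 < Num.sqrt 3 * M by rewrite mulr_gt0// sqrtr_gt0.
  split.
  - by apply: le_trans e1; exact: ltW.
  - by apply: lt_le_trans (_ : eta_ p K.+1 t <= _); [exact: lt_le_trans e1|rewrite lerDr].
  - have -> : 3 * M ^+ 2 = (Num.sqrt 3 * M) * (Num.sqrt 3 * M).
      by rewrite -expr2 exprMn sqr_sqrtr.
    apply: ler_pM; [exact: ltW|exact: ltW|exact: e1|].
    by apply: (le_trans e1); rewrite lerDr.
  - exact: sliding_etaS.
rewrite [eta_ p K.+1 (T_ p K.+1).+1]sliding_etaS.
have -> : (T_ p K.+1)%:R * beta_ p K.+1 + eta_ p K.+1 1 = 3 * L * (T_ p K.+1)%:R / K.+1%:R.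
  by rewrite /=; field; exact: lt0r_neq0.
have -> : beta_ p K.+1 + eta_ p K.+1 (T_ p K.+1) = 3 * L * (T_ p K.+1)%:R / K.+1%:R.
  by rewrite /=; field; exact: lt0r_neq0.
set S := \sum_(1 <= t < _) _; set T : R := (T_ p K.+1)%:R in TR *.
set Q := gap _ _ _ _ _ in IH *; set Q' := gap _ _ _ (z_bar it K.+1) _.
set V := bregman pi (z_out it K) z in IH *; set V' := bregman pi (z_out it K.+1) z.
have -> : gamma_ p K.+1 = 2 / K.+2%:R by [].
set c : R := K.+1%:R in KR K2 *; rewrite -/c in IH.
have cK : K%:R = c - 1 by rewrite /c -natr1 addrK.
have c20 : c + 1 != 0 by rewrite -K2 lt0r_neq0.
rewrite K2 /= -/V -/V' => h.
have := ler_wpM2l (ltW (mulr_gt0 KR KR2)) h.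
have -> : c * K.+2%:R * ((1 - 2 / (c + 1)) * Q + 2 / (c + 1) / T *
    (3 * L * T / c * V - 3 * L * T / c * V' + S)) =
    K%:R * c * Q + 6 * L * (V - V') + 2 * c / T * S.
  by rewrite K2 cK; field; rewrite !lt0r_neq0//= c20.
rewrite K2; move: IH; lra.
Qed.

End sliding_bound.

(** * Monotonicity of the integral and Borel row vectors *)

Section integral_monotone.
Context d (T : measurableType d) (R : realType).
Variable mu : {measure set T -> \bar R}.
Local Open Scope ereal_scope.
Import HBNNSimple.

(** The integral is defined as the lower integral of the positive part minus the
    lower integral of the negative part, and both are monotone for arbitrary
    functions. *)
Lemma le_integral_lower (f g : T -> \bar R) : (forall x, f x <= g x) ->
  \int[mu]_x f x <= \int[mu]_x g x.
Proof.
have mono (a b : T -> \bar R) : (forall x, 0 <= a x) -> (forall x, a x <= b x) ->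
    \int[mu]_x a x <= \int[mu]_x b x.
  move=> a0 ab; have b0 x : 0 <= b x := le_trans (a0 x) (ab x).
  rewrite !ge0_integralTE//; apply: le_ereal_sup => _ [h /= ha <-].
  by exists h => //= x; exact: le_trans (ha x) (ab x).
move=> fg; rewrite integralE [leRHS]integralE; apply: leeB.
  apply: mono => x; first exact: funepos_ge0.
  by rewrite !funeposE ge_max !le_max fg lexx !orbT.
apply: mono => x; first exact: funeneg_ge0.
by rewrite !funenegE ge_max !le_max leeN2 fg lexx orbT.
Qed.

End integral_monotone.

Section borel_row_vectors.
Context {R : realType}.

Lemma measurable_closed_rV n (A : set 'rV[R]_n) : closed A ->
  measurable (A : set (borel_rV R n)).
Proof.
move=> cA; rewrite -[A]setCK; apply: measurableC.
by apply: sub_sigma_algebra; exact: closed_openC.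
Qed.

(** The preimage of an open set is the preimage by [xi] of a union of balls.
    Continuity is only required between values that [xi] attains, so that the
    lemma applies to maps that are regular on a subset alone. *)
Lemma measurable_rel_continuous n m d (T : measurableType d) (xi : T -> 'rV[R]_n)
    (f : T -> 'rV[R]_m) :
  measurable_fun setT (xi : T -> borel_rV R n) ->
  (forall w e, 0 < e -> exists2 r, 0 < r &
     forall w', `|xi w - xi w'| < r -> `|f w - f w'| < e) ->
  measurable_fun setT (f : T -> borel_rV R m).
Proof.
move=> mxi cf; apply: (@measurability _ _ _ (borel_rV R m) _ _ (@open 'rV[R]_m)) => // _ [A oA <-].
rewrite setTI.
pose B := \bigcup_(c in [set c : 'rV[R]_n * R | forall w', `|c.1 - xi w'| < c.2 ->
  A (f w')]) ball c.1 c.2.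
have -> : f @^-1` A = xi @^-1` B.
  apply/seteqP; split=> w /=.
    move=> Afw; move: oA; rewrite openE => /(_ _ Afw)/nbhs_ballP[e /= e0 eA].
    have [r r0 hr] := cf w e e0; exists (xi w, r) => /=; last exact: ballxx.
    by move=> w' /hr h; apply: eA; rewrite -ball_normE.
  by move=> [c /= cA]; rewrite -ball_normE /= => /cA.
rewrite -[X in measurable X]setTI; apply: mxi => //.
apply: sub_sigma_algebra; apply: bigcup_open => c _; exact: ball_open.
Qed.

Lemma measurable_rel_lipschitz n m d (T : measurableType d) (xi : T -> 'rV[R]_n)
    (f : T -> 'rV[R]_m) (K : R) : 0 < K ->
  measurable_fun setT (xi : T -> borel_rV R n) ->
  (forall w w', `|f w - f w'| <= K * `|xi w - xi w'|) ->
  measurable_fun setT (f : T -> borel_rV R m).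
Proof.
move=> K0 mxi lf; apply: (measurable_rel_continuous mxi) => w e e0.
exists (e / K) => [|w' h]; first by rewrite divr_gt0.
by apply: (le_lt_trans (lf _ _)); rewrite mulrC -ltr_pdivlMr.
Qed.

Lemma measurable_continuous_at n m d (T : measurableType d) (xi : T -> 'rV[R]_n)
    (g : 'rV[R]_n -> 'rV[R]_m) :
  measurable_fun setT (xi : T -> borel_rV R n) ->
  (forall w, {for xi w, continuous g}) ->
  measurable_fun setT (g \o xi : T -> borel_rV R m).
Proof.
move=> mxi cg; apply: (measurable_rel_continuous mxi) => w e e0.
have /cvgrPdist_lt/(_ _ e0)/nbhs_ballP[r /= r0 hr] := cg w.
by exists r => // w' h; apply: hr; rewrite -ball_normE.
Qed.

Lemma measurable_coord n (i : 'I_n) :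
  measurable_fun setT (fun x : borel_rV R n => (x : 'rV[R]_n) ord0 i).
Proof.
apply: (measurability _ (RGenOpens.measurableE R)) => _ [_ [a [b ->]] <-].
rewrite setTI; apply: sub_sigma_algebra.
have : continuous (fun x : 'rV[R]_n => x ord0 i) by exact: coord_continuous.
by move/continuousP; apply; exact: itv_open.
Qed.

(** Every open set is a countable union of closed boxes with rational centres
    and radii. *)
Lemma measurable_rV n d (T : measurableType d) (f : T -> 'rV[R]_n) :
  (forall i, measurable_fun setT (fun w => f w ord0 i)) ->
  measurable_fun setT (f : T -> borel_rV R n).
Proof.
move=> mf; apply: (@measurability _ _ _ (borel_rV R n) _ _ (@open 'rV[R]_n)) => // _ [A oA <-].
rewrite setTI.
pose c (q : 'rV[rat]_n * rat) : 'rV[R]_n := map_mx ratr q.1.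
pose good := [set q : 'rV[rat]_n * rat | forall x, `|c q - x| <= ratr q.2 -> A x].
have -> : f @^-1` A =
    \bigcup_q (if q \in good then [set w | `|c q - f w| <= ratr q.2] else set0).
  apply/seteqP; split=> w /=; last first.
    by move=> [q _]; case: ifPn => // /[!inE] gq /= /gq.
  move=> Afw; move: oA; rewrite openE => /(_ _ Afw)/nbhs_ballP[e /= e0 eA].
  have [r /itvP re] : exists r, ratr r \in `]0, e / 2[ by apply: rat_in_itvoo; rewrite divr_gt0.
  have r0 : 0 < ratr r :> R by rewrite re.
  have re2 : ratr r < e / 2 :> R by rewrite re.
  have q_ex i : exists q, `|ratr q - f w ord0 i| <= ratr r :> R.
    have [q /itvP qw] : exists q, ratr q \in `]f w ord0 i - ratr r, f w ord0 i + ratr r[.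
      by apply: rat_in_itvoo; lra.
    by exists q; rewrite ler_distl ltW ?qw// ltW ?qw.
  have [q hq] := choice q_ex.
  have close : `|c (\row_i q i, r) - f w| <= ratr r.
    by apply: ler_norm_coord => [|i]; [exact: ltW|rewrite !mxE; exact: hq].
  exists (\row_i q i, r) => //; rewrite mem_set//= => x /= hx; apply: eA.
  rewrite -ball_normE /=; apply: (le_lt_trans (ler_distD (c (\row_i q i, r)) _ _)).
  by rewrite distrC; move: close hx re2; rewrite /=; lra.
apply: countable_bigcupT_measurable => [|q]; first exact: countableP.
case: ifPn => // _.
have [q0|q0] := leP 0 (ratr q.2 : R); last first.
  rewrite (_ : [set w | _] = set0)//; apply/seteqP; split=> w //= h.
  by have := le_lt_trans h q0; rewrite normr_lt0.
rewrite (_ : [set w | _] = \bigcap_(i in [set: 'I_n])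
    [set w | `|c q ord0 i - f w ord0 i| <= ratr q.2]).
  apply: fin_bigcap_measurable => // i _.
  rewrite -[X in measurable X]setTI.
  have mi : measurable_fun setT (fun w => `|c q ord0 i - f w ord0 i|).
    by apply: measurableT_comp => //; exact: measurable_funB.
  have <- : (fun w => `|c q ord0 i - f w ord0 i|) @^-1` `]-oo, ratr q.2] =
      [set w | `|c q ord0 i - f w ord0 i| <= ratr q.2].
    by apply/seteqP; split=> w /=; rewrite in_itv.
  exact: (mi measurableT `]-oo, ratr q.2]%classic (measurable_itv _)).
apply/seteqP; split=> w /= h.
  move=> i _ /=; apply: le_trans h.
  by have := ler_coord_norm (c q - f w) i; rewrite !mxE.
by apply: ler_norm_coord => // i; have := h i I; rewrite !mxE.
Qed.

End borel_row_vectors.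

(** * Independence and iterated means *)

Section independent_pair.
Context d d1 d2 (T : measurableType d) (Y1 : measurableType d1)
  (Y2 : measurableType d2) (R : realType) (P : probability T R).
Variables (U : T -> Y1) (W : T -> Y2).
Hypotheses (mU : measurable_fun setT U) (mW : measurable_fun setT W).
Hypothesis UW : forall A B, measurable A -> measurable B ->
  P (U @^-1` A `&` W @^-1` B) = (P (U @^-1` A) * P (W @^-1` B))%E.
Local Open Scope ereal_scope.

(** The joint law of an independent pair is the product of its laws, so
    Tonelli's theorem applies to it. *)
Lemma indep_tonelli (h : Y1 * Y2 -> \bar R) :
  measurable_fun setT h -> (forall y, 0 <= h y) ->
  \int[P]_w h (U w, W w) = \int[P]_w \int[P]_w' h (U w, W w').
Proof.
move=> mh h0.
pose U' : {mfun T >-> Y1} := mfun_Sub (mem_set mU).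
pose W' : {mfun T >-> Y2} := mfun_Sub (mem_set mW).
have mp : measurable_fun setT (fun w => (U w, W w)) by exact: measurable_fun_pair.
pose UW' : {mfun T >-> (Y1 * Y2)%type} := mfun_Sub (mem_set mp).
pose m1 := distribution P U'; pose m2 := distribution P W'.
transitivity (\int[distribution P UW']_y h y).
  by rewrite ge0_integral_pushforward// preimage_setT.
transitivity (\int[m1 \x m2]_y h y).
  apply: eq_measure_integral => A mA _; apply/esym.
  exact: product_measure_unique.
have mF : measurable_fun setT (fubini_F m2 h) by exact: measurable_fun_fubini_tonelli_F.
have F0 y : 0 <= fubini_F m2 h y by exact: integral_ge0.
rewrite fubini_tonelli1// ge0_integral_pushforward//.
rewrite preimage_setT; apply: eq_integral => w _ /=.
rewrite /fubini_F ge0_integral_pushforward//; last exact: measurableT_comp.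
Qed.

Lemma measurable_indep_inner (h : Y1 * Y2 -> \bar R) :
  measurable_fun setT h -> (forall y, 0 <= h y) ->
  measurable_fun setT (fun w => \int[P]_w' h (U w, W w')).
Proof.
move=> mh h0; pose W' : {mfun T >-> Y2} := mfun_Sub (mem_set mW).
rewrite (_ : (fun w => _) = fubini_F (distribution P W') h \o U).
  by apply: measurableT_comp => //; exact: measurable_fun_fubini_tonelli_F.
apply/funext => w /=; rewrite /fubini_F ge0_integral_pushforward//.
exact: measurableT_comp.
Qed.

Lemma indep_integral_le (h : Y1 * Y2 -> \bar R) (c : R) : (0 <= c)%R ->
  measurable_fun setT h -> (forall y, 0 <= h y) ->
  {ae P, forall w, \int[P]_w' h (U w, W w') <= c%:E} ->
  \int[P]_w h (U w, W w) <= c%:E.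
Proof.
move=> c0 mh h0 hc; rewrite indep_tonelli//.
rewrite -[leRHS]mule1 -(@probability_setT _ _ _ P) -integral_cst//.
apply: ae_ge0_le_integral => //.
- by move=> w _; exact: integral_ge0.
- exact: measurable_indep_inner.
- by apply: filterS hc => w + _.
Qed.

(** Tonelli's theorem expresses the integrals of the positive and negative parts
    of [h] by inner integrals, which agree almost surely. *)
Lemma indep_integral_eq0 (h : Y1 * Y2 -> R) :
  measurable_fun setT h -> P.-integrable setT (fun w => (h (U w, W w))%:E) ->
  {ae P, forall w, \int[P]_w' (h (U w, W w'))%:E = 0} ->
  \int[P]_w (h (U w, W w))%:E = 0.
Proof.
move=> mh ih h0; pose h' y := (h y)%:E.
have mh' : measurable_fun setT h' by exact/measurable_EFinP.
have mp := measurable_funepos mh'; have mn := measurable_funeneg mh'.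
have hp : (fun w => (h (U w, W w))%:E)^\+ = fun w => h'^\+ (U w, W w).
  by apply/funext => w; rewrite !funeposE.
have fp : \int[P]_w h'^\+ (U w, W w) \is a fin_num.
  by rewrite -hp; exact: integrable_pos_fin_num.
rewrite integralE hp.
have -> : (fun w => (h (U w, W w))%:E)^\- = fun w => h'^\- (U w, W w).
  by apply/funext => w; rewrite !funenegE.
rewrite [in X in _ - X]indep_tonelli//.
have -> : \int[P]_w \int[P]_w' h'^\- (U w, W w') = \int[P]_w \int[P]_w' h'^\+ (U w, W w').
  apply: ge0_ae_eq_integral => //.
  - exact: measurable_indep_inner.
  - exact: measurable_indep_inner.
  - by move=> w _; exact: integral_ge0.
  - by move=> w _; exact: integral_ge0.
  apply: filterS h0 => w + _; rewrite integralE.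
  have -> : (fun w' => (h (U w, W w'))%:E)^\+ = fun w' => h'^\+ (U w, W w').
    by apply/funext => w'; rewrite !funeposE.
  have -> : (fun w' => (h (U w, W w'))%:E)^\- = fun w' => h'^\- (U w, W w').
    by apply/funext => w'; rewrite !funenegE.
  set a := integral _ _ _; set b := integral _ _ _.
  have : 0 <= a by exact: integral_ge0.
  have : 0 <= b by exact: integral_ge0.
  clearbody a b; case: a b => [a| |] [b| |] //= _ _ /eqP.
  by rewrite -EFinB eqe subr_eq0 => /eqP ->.
by rewrite -indep_tonelli// subee.
Qed.

End independent_pair.

Section independent_samples.
Context d dX (T : measurableType d) (X : measurableType dX) (R : realType)
  (P : probability T R) (I : choiceType).
Variable zeta : I -> T -> X.
Hypothesis mzeta : forall i, measurable_fun setT (zeta i).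

(** Unlike the events of single samples, these are stable by intersection, so that
    independence extends from them to the sigma-algebra they generate. *)
Definition cylinders (s : seq I) : set (set T) :=
  [set B | exists2 A : I -> set X, (forall i, measurable (A i)) &
    B = \bigcap_(i in [set` s]) (zeta i @^-1` A i)].

Definition sigma_of (s : seq I) := g_sigma_algebraType (cylinders s).

Lemma measurable_sample s i : i \in s ->
  measurable_fun setT (zeta i : sigma_of s -> X).
Proof.
move=> si _ A mA; rewrite setTI; apply: sub_sigma_algebra.
exists (fun j => if j == i then A else setT) => [j|].
  by case: ifP.
apply/seteqP; split=> w /= h.
  by move=> j _ /=; case: eqP => // ->.
by have := h i si; rewrite /= eqxx.
Qed.

Lemma cylinders_sub s s' : {subset s <= s'} -> cylinders s `<=` cylinders s'.
Proof.
move=> ss' _ [A mA ->]; exists (fun j => if j \in s then A j else setT) => [j|].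
  by case: ifP.
apply/seteqP; split=> w /= h i si /=.
  by case: ifPn => // is_; exact: h.
by have := h i (ss' i si); rewrite /= si.
Qed.

Lemma sigma_of_sub s s' : {subset s <= s'} ->
  <<s cylinders s >> `<=` <<s cylinders s' >>.
Proof. by move=> /cylinders_sub ss'; exact: sub_smallest2r. Qed.

Lemma sigma_of_measurable s : <<s cylinders s >> `<=` @measurable _ T.
Proof.
apply: smallest_sub; first exact: sigma_algebra_measurable.
move=> _ [A mA ->]; apply: fin_bigcap_measurable => // i _.
by rewrite -[X in measurable X]setTI; exact: mzeta.
Qed.

Lemma measurable_sigma_of_sub d' (Y : measurableType d') s s' (f : T -> Y) :
  {subset s <= s'} -> measurable_fun setT (f : sigma_of s -> Y) ->
  measurable_fun setT (f : sigma_of s' -> Y).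
Proof. by move=> ss' mf _ A mA; apply: (sigma_of_sub ss'); exact: mf. Qed.

Lemma measurable_of_sigma d' (Y : measurableType d') s (f : T -> Y) :
  measurable_fun setT (f : sigma_of s -> Y) -> measurable_fun setT f.
Proof. by move=> mf _ A mA; apply: (@sigma_of_measurable s); exact: mf. Qed.

Variable D : set I.
Hypothesis indep : mutually_independent P D zeta.

Lemma cylinder_indep s j A B : j \notin s -> D j -> {in s, forall i, D i} ->
  cylinders s B -> measurable A ->
  P (B `&` zeta j @^-1` A) = (P B * P (zeta j @^-1` A))%E.
Proof.
move=> js Dj Ds [C mC ->] mA; set s' := undup s.
have -> : \bigcap_(i in [set` s]) (zeta i @^-1` C i) =
    \big[setI/setT]_(i <- s') (zeta i @^-1` C i).
  rewrite -bigcap_seq; congr (\bigcap_(i in _) _).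
  by apply/seteqP; split=> i /=; rewrite mem_undup.
have Ds' i : i \in s' -> D i by rewrite mem_undup; exact: Ds.
have us' : uniq s' by exact: undup_uniq.
have js' : j \notin s' by rewrite mem_undup.
rewrite (indep us' Ds' mC).
pose C' i := if i == j then A else C i.
have mC' i : measurable (C' i) by rewrite /C'; case: ifP.
have CC' i : i \in s' -> C' i = C i.
  by move=> is'; rewrite /C'; case: eqP => // ij; rewrite -ij is' in js'.
have uj : uniq (j :: s') by rewrite /= js'.
have Dj' i : i \in j :: s' -> D i by rewrite inE => /orP[/eqP ->|/Ds'].
have C'j : C' j = A by rewrite /C' eqxx.
have := indep uj Dj' mC'; rewrite !big_cons C'j.
have -> : \big[setI/setT]_(i <- s') (zeta i @^-1` C' i) =
    \big[setI/setT]_(i <- s') (zeta i @^-1` C i).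
  by apply: eq_big_seq => i /CC' ->.
have -> : (\prod_(i <- s') P (zeta i @^-1` C' i))%E =
    (\prod_(i <- s') P (zeta i @^-1` C i))%E.
  by apply: eq_big_seq => i /CC' ->.
by move=> e; rewrite setIC muleC.
Qed.

(** Both sides are finite measures in [B] that agree on the pi-system of
    cylinders. *)
Lemma sigma_of_indep s j A B : j \notin s -> D j -> {in s, forall i, D i} ->
  <<s cylinders s >> B -> measurable A ->
  P (B `&` zeta j @^-1` A) = (P B * P (zeta j @^-1` A))%E.
Proof.
move=> js Dj Ds sB mA.
have mzA : measurable (zeta j @^-1` A) by rewrite -[X in measurable X]setTI; exact: mzeta.
have f0 : (0 <= fine (P (zeta j @^-1` A)))%R by apply: fine_ge0.
pose m1 := mrestr P mzA; pose m2 := mscale (NngNum f0) P.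
suff : m1 B = m2 B.
  by rewrite /m1 /m2 /mrestr /mscale/= fineK ?fin_num_measure// muleC.
apply: (g_sigma_algebra_measure_unique (cylinders s) _ (fun=> setT)) => //.
- by move=> C /(@sub_sigma_algebra _ setT)/sigma_of_measurable.
- by move=> _; exists (fun=> setT) => //; apply/seteqP; split.
- by rewrite bigcup_const.
- move=> _ _ [C mC ->] [C' mC' ->]; exists (fun i => C i `&` C' i).
    by move=> i; exact: measurableI.
  by rewrite -bigcapI.
- move=> C cC; rewrite [LHS](@cylinder_indep s j)// muleC.
  by rewrite -[in LHS](fineK (fin_num_measure P _ mzA)).
- move=> _; apply: (le_lt_trans (probability_le1 P (measurableI _ _ measurableT mzA))).
  exact: ltry.
Qed.

End independent_samples.

(** * Moments of one oracle call *)

Section vector_measurability.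
Context {R : realType} {n : nat} {nrm : 'rV[R]_n -> R} (Hn : is_norm nrm).
Context d (T : measurableType d).
Implicit Types f g : T -> 'rV[R]_n.
Notation mfun_rV f := (measurable_fun setT (f : T -> borel_rV R n)).

Lemma measurable_rV_coord f i : mfun_rV f -> measurable_fun setT (fun w => f w ord0 i).
Proof. by move=> mf; apply: (measurableT_comp (measurable_coord i)). Qed.

Lemma measurable_rVD f g : mfun_rV f -> mfun_rV g -> mfun_rV (fun w => f w + g w).
Proof.
move=> mf mg; apply: measurable_rV => i.
under eq_fun do rewrite mxE.
by apply: measurable_funD; exact: measurable_rV_coord.
Qed.

Lemma measurable_rVZ a f : mfun_rV f -> mfun_rV (fun w => a *: f w).
Proof.
move=> mf; apply: measurable_rV => i.
under eq_fun do rewrite mxE.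
by apply: measurable_funM => //; exact: measurable_rV_coord.
Qed.

Lemma measurable_rVB f g : mfun_rV f -> mfun_rV g -> mfun_rV (fun w => f w - g w).
Proof.
move=> mf mg; under eq_fun do rewrite -scaleN1r.
by apply: measurable_rVD => //; exact: measurable_rVZ.
Qed.

Lemma measurable_rV_sum (I : eqType) (s : seq I) (F : I -> T -> 'rV[R]_n) :
  (forall i, i \in s -> mfun_rV (F i)) -> mfun_rV (fun w => \sum_(i <- s) F i w).
Proof.
elim: s => [|i s IH] h.
  by under eq_fun do rewrite big_nil; exact: measurable_cst.
under eq_fun do rewrite big_cons; apply: measurable_rVD.
  by apply: h; rewrite mem_head.
by apply: IH => j js; apply: h; rewrite inE js orbT.
Qed.

Lemma measurable_dot f g : mfun_rV f -> mfun_rV g ->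
  measurable_fun setT (fun w => dot (f w) (g w)).
Proof.
move=> mf mg; apply: measurable_sum => i.
by apply: measurable_funM; exact: measurable_rV_coord.
Qed.

Lemma measurable_dual_norm f : mfun_rV f ->
  measurable_fun setT (fun w => dual_norm nrm (f w)).
Proof.
move=> mf; have [K K0 HK] := dual_le_sup_norm Hn.
pose g w : 'rV[R]_1 := const_mx (dual_norm nrm (f w)).
have mg : measurable_fun setT (g : T -> borel_rV R 1).
  apply: (measurable_rel_lipschitz K0 mf) => w w'.
  apply: ler_norm_coord => [|i]; first by rewrite mulr_ge0// ltW.
  rewrite !mxE; apply: le_trans (HK _); rewrite ler_norml.
  have h1 := dual_normD Hn (f w - f w') (f w').
  have h2 := dual_normD Hn (f w' - f w) (f w).
  rewrite -opprB (dual_normN Hn) in h2; rewrite !subrK opprB subrK in h1 h2.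
  by apply/andP; split; lra.
have := measurableT_comp (measurable_coord ord0) mg.
by apply: eq_measurable_fun => w _; rewrite /g /= mxE.
Qed.

End vector_measurability.

Section argmin_measurability.
Context {R : realType} {n : nat} {nrm : 'rV[R]_n -> R} (Hn : is_norm nrm).
Variables (Z : set 'rV[R]_n) (J pi : 'rV[R]_n -> R).
Hypotheses (cZ : convex_set Z) (cJ : convex_function Z J)
  (pp : prox_function nrm Z pi).
Context d (T : measurableType d).
Notation mfun_rV f := (measurable_fun setT (f : T -> borel_rV R n)).

Lemma measurable_grad_prox (u : T -> 'rV[R]_n) : (forall w, Z (u w)) ->
  mfun_rV u -> mfun_rV (fun w => grad pi (u w)).
Proof.
move=> Zu mu; apply: (measurable_continuous_at (g := grad pi) mu) => w.
by case: pp => -[U [_ ZU cd]] _; have [] := cd _ (ZU _ (Zu w)).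
Qed.

Lemma measurable_argmin (xi u v f : T -> 'rV[R]_n) (b eta : R) : 0 < b + eta ->
  (forall w, Z (u w)) -> (forall w, Z (v w)) ->
  (forall w, argmin Z (subproblem J pi (xi w) b eta (u w) (v w)) (f w)) ->
  mfun_rV xi -> mfun_rV u -> mfun_rV v -> mfun_rV f.
Proof.
move=> be0 Zu Zv mf mxi mu mv.
have [K K0 HK] := sup_norm_le_nrm Hn; have [K' K'0 HK'] := dual_le_sup_norm Hn.
pose eff w := xi w - b *: grad pi (u w) - eta *: grad pi (v w).
have meff : mfun_rV eff.
  apply: measurable_rVB; first apply: measurable_rVB => //.
    by apply: measurable_rVZ; exact: measurable_grad_prox.
  by apply: measurable_rVZ; exact: measurable_grad_prox.
have KK : 0 < K * K' / (b + eta) by rewrite divr_gt0// mulr_gt0.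
apply: (measurable_rel_lipschitz KK meff) => w w'.
apply: (le_trans (HK _)).
have h : nrm (f w - f w') <= K' * `|eff w - eff w'| / (b + eta).
  rewrite ler_pdivlMr// mulrC; apply: le_trans (HK' _).
  exact: (argmin_lipschitz Hn cZ cJ pp be0 (mf w) (mf w')).
by rewrite -!mulrA [(b + eta)^-1 * _]mulrC ler_pM2l// mulrA.
Qed.

End argmin_measurability.

Section oracle_noise.
Context {R : realType} {n : nat} {nrm : 'rV[R]_n -> R} (Hn : is_norm nrm).
Variables (Z : set 'rV[R]_n) (H : 'rV[R]_n -> 'rV[R]_n) (M : R) (z0 : 'rV[R]_n).
Hypotheses (compZ : compact Z) (Zz0 : Z z0) (M0 : 0 < M)
  (lH : lipschitz_dual nrm Z H M).
Context dX (X : measurableType dX) (Hs : 'rV[R]_n -> X -> 'rV[R]_n).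
Hypothesis mHs : measurable_fun (Z `*` setT : set (borel_rV R n * X))
    (fun zx : borel_rV R n * X => Hs zx.1 zx.2 : borel_rV R n).

Lemma measurable_feasible : measurable (Z : set (borel_rV R n)).
Proof.
apply: measurable_closed_rV; apply: compact_closed => //; exact: norm_hausdorff.
Qed.

Lemma measurable_oracle_comp d (T : measurableType d) (U : T -> 'rV[R]_n) (W : T -> X) :
  (forall w, Z (U w)) -> measurable_fun setT (U : T -> borel_rV R n) ->
  measurable_fun setT W ->
  measurable_fun setT (fun w => Hs (U w) (W w) : borel_rV R n).
Proof.
move=> ZU mU mW.
have := @measurable_comp _ _ _ T (borel_rV R n * X)%type (borel_rV R n)
  (Z `*` setT) (fun zx => Hs zx.1 zx.2) setT (fun w => (U w, W w)).
apply => //; last exact: measurable_fun_pair.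
- by apply: measurableX => //; exact: measurable_feasible.
- by move=> _ [w _ <-]; split => //=; exact: ZU.
Qed.

Lemma measurable_operator_comp d (T : measurableType d) (U : T -> 'rV[R]_n) :
  (forall w, Z (U w)) -> measurable_fun setT (U : T -> borel_rV R n) ->
  measurable_fun setT (fun w => H (U w) : borel_rV R n).
Proof.
move=> ZU mU; have [K K0 HK] := sup_norm_le_dual Hn.
have [K' K'0 HK'] := nrm_le_sup_norm Hn.
have KK : 0 < K * (M * K') by rewrite !mulr_gt0.
apply: (measurable_rel_lipschitz KK mU) => w w'.
apply: (le_trans (HK _)); rewrite -mulrA ler_pM2l// -mulrA.
apply: (le_trans (lH (ZU w) (ZU w'))); rewrite ler_pM2l//.
Qed.

(** Sending the points outside [Z] to [z0] makes the oracle total without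
    changing it along the iterates. *)
Definition retract (z : 'rV[R]_n) := if z \in Z then z else z0.

Lemma retract_mem z : Z (retract z).
Proof. by rewrite /retract; case: ifPn => // /set_mem. Qed.

Lemma retract_id z : Z z -> retract z = z.
Proof. by move=> Zz; rewrite /retract mem_set. Qed.

Lemma measurable_retract :
  measurable_fun setT (retract : borel_rV R n -> borel_rV R n).
Proof.
apply: measurable_fun_ifT => //.
apply: (measurable_fun_bool true); rewrite setTI.
rewrite [X in measurable X](_ : _ = Z); first exact: measurable_feasible.
by apply/seteqP; split=> z /= zZ; [exact: set_mem|exact: mem_set].
Qed.

Definition deviation (zx : borel_rV R n * X) : 'rV[R]_n :=
  Hs (retract zx.1) zx.2 - H (retract zx.1).

Lemma measurable_deviation :
  measurable_fun setT (deviation : borel_rV R n * X -> borel_rV R n).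
Proof.
have mr : measurable_fun setT (fun zx : borel_rV R n * X => retract zx.1 : borel_rV R n).
  exact: (measurableT_comp measurable_retract measurable_fst).
apply: measurable_rVB.
  by apply: measurable_oracle_comp => // zx; exact: retract_mem.
by apply: measurable_operator_comp => // zx; exact: retract_mem.
Qed.

Context d (T : measurableType d) (P : probability T R) (sigma : R).
Variables (U : T -> 'rV[R]_n) (W : T -> X).
Hypotheses (ZU : forall w, Z (U w))
  (mU : measurable_fun setT (U : T -> borel_rV R n)) (mW : measurable_fun setT W).
Hypothesis UW : forall (A : set (borel_rV R n)) B, measurable A -> measurable B ->
  P (U @^-1` A `&` W @^-1` B) = (P (U @^-1` A) * P (W @^-1` B))%E.
Hypothesis oracle :
  {ae P, forall w, unbiased_bounded_variance_at P nrm H Hs sigma W (U w)}.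

Let mh2 : measurable_fun setT (fun zx => (dual_norm nrm (deviation zx) ^+ 2)%:E).
Proof.
apply/measurable_EFinP; apply: measurable_funX.
apply: (measurable_dual_norm Hn); exact: measurable_deviation.
Qed.

(** The oracle condition at a frozen point becomes a bound along the random point
    [U], as the sample [W] is independent of [U]. *)
Lemma oracle_second_moment :
  (\int[P]_w (dual_norm nrm (Hs (U w) (W w) - H (U w)) ^+ 2)%:E <= (sigma ^+ 2)%:E)%E.
Proof.
have := indep_integral_le mU mW UW (sqr_ge0 sigma) mh2.
rewrite /deviation /=; under eq_integral do rewrite (retract_id (ZU _)).
apply=> [zx|]; first by rewrite lee_fin sqr_ge0.
apply: filterS oracle => w [_]; rewrite unlock.
by under [X in _ -> (X <= _)%E]eq_integral do rewrite (retract_id (ZU _)).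
Qed.

Lemma measurable_noise : measurable_fun setT (fun w => Hs (U w) (W w) - H (U w) : borel_rV R n).
Proof.
by apply: measurable_rVB; [exact: measurable_oracle_comp|exact: measurable_operator_comp].
Qed.

Lemma oracle_second_moment_integrable :
  P.-integrable setT (fun w => (dual_norm nrm (Hs (U w) (W w) - H (U w)) ^+ 2)%:E).
Proof.
apply/integrableP; split.
  apply/measurable_EFinP; apply: measurable_funX.
  exact: (measurable_dual_norm Hn measurable_noise).
under eq_integral do rewrite gee0_abs ?lee_fin ?sqr_ge0//.
exact: (le_lt_trans oracle_second_moment (ltry _)).
Qed.

(** A random vector whose dual norm is square integrable is integrable, since
    [c <= 1 + c ^+ 2]. *)
Let integrable_of_sq (V : T -> 'rV[R]_n) (f : T -> R) (B : R) : 0 <= B ->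
  measurable_fun setT (V : T -> borel_rV R n) -> measurable_fun setT f ->
  (\int[P]_w (dual_norm nrm (V w) ^+ 2)%:E < +oo)%E ->
  (forall w, `|f w| <= B * dual_norm nrm (V w)) ->
  P.-integrable setT (EFin \o f).
Proof.
move=> B0 mV mf V2 fB.
have iV : P.-integrable setT (fun w => (dual_norm nrm (V w) ^+ 2)%:E).
  apply/integrableP; split.
    apply/measurable_EFinP; apply: measurable_funX.
    exact: (measurable_dual_norm Hn mV).
  by under eq_integral do rewrite gee0_abs ?lee_fin ?sqr_ge0//.
have i1 : P.-integrable setT (EFin \o cst (1 : R)).
  exact: finite_measure_integrable_cst.
have := integrableZl measurableT B (integrableD measurableT i1 iV).
apply: le_integrable => //; first exact/measurable_EFinP.
move=> w _ /=; rewrite lee_fin; apply: (le_trans (fB w)).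
rewrite [leRHS]ger0_norm ?mulr_ge0 ?addr_ge0 ?sqr_ge0//.
apply: ler_wpM2l => //.
have := sqr_ge0 (dual_norm nrm (V w) - 1); have := dual_norm_ge0 Hn (V w).
rewrite !expr2; lra.
Qed.

Let coord_bound : exists2 K, 0 < K & forall (x : 'rV[R]_n) i,
  `|x ord0 i| <= K * dual_norm nrm x.
Proof.
have [K K0 HK] := sup_norm_le_dual Hn.
by exists K => // x i; apply: le_trans (HK x); exact: ler_coord_norm.
Qed.

Let inner_mean_eq0 u y : Z u -> unbiased_bounded_variance_at P nrm H Hs sigma W u ->
  (\int[P]_w' (dot (Hs u (W w') - H u) y)%:E = 0)%E.
Proof.
move=> Zu [mean var]; have [K K0 HK] := coord_bound.
have mH : measurable_fun setT (fun w => Hs u (W w) - H u : borel_rV R n).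
  apply: measurable_rVB => //.
  by apply: (measurable_oracle_comp (U := cst u)).
have mc i : measurable_fun setT (fun w => (Hs u (W w) - H u) ord0 i).
  exact: (measurable_rV_coord i mH).
have var' : (\int[P]_w (dual_norm nrm (Hs u (W w) - H u) ^+ 2)%:E < +oo)%E.
  by move: var; rewrite unlock => /le_lt_trans; apply; exact: ltry.
have ic i : P.-integrable setT (fun w => ((Hs u (W w) - H u) ord0 i)%:E).
  by apply: (integrable_of_sq (ltW K0) mH (mc i) var') => w; exact: HK.
have ih i : (\int[P]_w ((Hs u (W w) - H u) ord0 i)%:E = 0)%E.
  have iH : P.-integrable setT (EFin \o cst (H u ord0 i)).
    exact: finite_measure_integrable_cst.
  have iHs : P.-integrable setT (fun w => (Hs u (W w) ord0 i)%:E).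
    have := integrableD measurableT (ic i) iH.
    by apply: eq_integrable => // w _ /=; rewrite !mxE -EFinD subrK.
  under eq_integral do rewrite !mxE EFinB.
  rewrite integralB//; have := mean i; rewrite unlock => ->.
  by have := expectation_cst P (H u ord0 i); rewrite unlock => ->; rewrite subee.
rewrite /dot; under eq_integral do rewrite -sumEFin.
rewrite integral_sum// => [|i].
  apply: big1 => i _; under eq_integral do rewrite mulrC EFinM.
  by rewrite integralZl// ih mule0.
under eq_fun do rewrite mulrC EFinM.
exact: integrableZl.
Qed.

Lemma oracle_dot_integrable z :
  P.-integrable setT (fun w => (dot (Hs (U w) (W w) - H (U w)) (U w - z))%:E).
Proof.
have [K K0 HK] := nrm_le_sup_norm Hn.
have [B [_ hB]] := compact_bounded compZ.
have hU w : `|U w| <= `|B| + 1 by apply: hB (ZU w); rewrite ltr_pwDr// ler_norm.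
have b0 : 0 <= K * (`|B| + 1 + `|z|) by rewrite mulr_ge0 ?addr_ge0// ltW.
apply: (integrable_of_sq b0 measurable_noise).
- apply: measurable_dot; first exact: measurable_noise.
  by apply: measurable_rVB.
- exact: (le_lt_trans oracle_second_moment (ltry _)).
move=> w; set D := Hs _ _ - _.
have b : nrm (U w - z) <= K * (`|B| + 1 + `|z|).
  apply: (le_trans (HK _)); rewrite ler_pM2l//.
  by apply: (le_trans (ler_normB _ _)); rewrite lerD2r.
have h1 := ler_dot_dual Hn D (U w - z).
have h2 := ler_dot_dual Hn (- D) (U w - z).
rewrite dotNl (dual_normN Hn) in h2.
have h3 : dual_norm nrm D * nrm (U w - z) <= dual_norm nrm D * (K * (`|B| + 1 + `|z|)).
  by apply: ler_wpM2l => //; exact: dual_norm_ge0.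
by rewrite ler_norml; apply/andP; split; lra.
Qed.

Lemma oracle_dot_mean0 z :
  (\int[P]_w (dot (Hs (U w) (W w) - H (U w)) (U w - z))%:E = 0)%E.
Proof.
pose h (zx : borel_rV R n * X) := dot (deviation zx) (retract zx.1 - z).
have mh : measurable_fun setT h.
  apply: measurable_dot; first exact: measurable_deviation.
  apply: measurable_rVB => //.
  exact: (measurableT_comp measurable_retract measurable_fst).
have hE w w' : h (U w, W w') = dot (Hs (U w) (W w') - H (U w)) (U w - z).
  by rewrite /h /deviation /= retract_id.
under eq_integral do rewrite -hE.
apply: (indep_integral_eq0 mU mW UW mh).
  by under eq_fun do rewrite hE; exact: oracle_dot_integrable.
apply: filterS oracle => w ub; under eq_integral do rewrite hE.
exact: inner_mean_eq0.
Qed.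

End oracle_noise.

(** * Adaptedness of the iterates *)

(** Samples are drawn in the lexicographic order of outer iteration and position
    within it. *)
Definition past (Tk : nat -> nat) (k s : nat) : seq (nat * nat) :=
  [seq (k', s') | k' <- iota 1 k.-1, s' <- iota 1 (2 * Tk k')]
    ++ [seq (k, s') | s' <- iota 1 s].

Lemma mem_past Tk k s (i : nat * nat) : i \in past Tk k s =
  ((1 <= i.1 < k) && (1 <= i.2 <= 2 * Tk i.1) || (i.1 == k) && (1 <= i.2 <= s))%N.
Proof.
rewrite mem_cat; congr (_ || _).
  apply/allpairsPdep/idP => [[a [b [+ + ->]]]|/andP[h1 h2]] /=.
    by rewrite !mem_iota; lia.
  by exists i.1, i.2; rewrite !mem_iota -surjective_pairing; split=> //; lia.
apply/mapP/idP => [[b + ->]|/andP[/eqP h1 h2]] /=; rewrite ?mem_iota.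
  by rewrite eqxx; lia.
by exists i.2; [rewrite mem_iota; lia|rewrite -h1 -surjective_pairing].
Qed.

Section adapted_run.
Context {R : realType} {n : nat} {nrm : 'rV[R]_n -> R} (Hn : is_norm nrm).
Variables (Z : set 'rV[R]_n) (G J pi : 'rV[R]_n -> R).
Hypotheses (compZ : compact Z) (cZ : convex_set Z) (cdG : cont_diff_on setT G)
  (pp : prox_function nrm Z pi) (cJ : convex_function Z J).
Context dX (X : measurableType dX) (Hs : 'rV[R]_n -> X -> 'rV[R]_n).
Hypothesis mHs : measurable_fun (Z `*` setT : set (borel_rV R n * X))
    (fun zx : borel_rV R n * X => Hs zx.1 zx.2 : borel_rV R n).
Variables (z0 : 'rV[R]_n) (N : nat) (p : smps_params R).
Hypothesis Zz0 : Z z0.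
Context d (T : measurableType d) (P : probability T R).
Variables (zeta : nat -> nat -> {RV P >-> X}) (it : T -> smps_iterates R n).
Hypothesis run : forall w, smps_run Z G J pi Hs z0 N p (fun k s => zeta k s w) (it w).
Hypothesis T_gt0 : forall k, (1 <= k <= N)%N -> (0 < T_ p k)%N.
Hypothesis be_gt0 : forall k t, (1 <= k <= N)%N -> (1 <= t <= T_ p k)%N ->
  0 < beta_ p k + eta_ p k t.

Let sample (i : nat * nat) : T -> X := zeta i.1 i.2.

Definition adapted k s (f : T -> 'rV[R]_n) :=
  measurable_fun setT (f : sigma_of sample (past (T_ p) k s) -> borel_rV R n).

Lemma adapted_le k s s' f : (s <= s')%N -> adapted k s f -> adapted k s' f.
Proof.
move=> ss'; apply: measurable_sigma_of_sub => i; rewrite !mem_past; lia.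
Qed.

Lemma adapted_next k f : (0 < k)%N ->
  adapted k (2 * T_ p k) f -> adapted k.+1 0 f.
Proof.
move=> k0; apply: measurable_sigma_of_sub => -[a b]; rewrite !mem_past /=.
case/orP => [h|/andP[/eqP -> h]]; apply/orP; left; lia.
Qed.

Lemma adapted_inner_step k t :
  (1 <= k <= N)%N -> (1 <= t <= T_ p k)%N ->
  adapted k 0 (fun w => z_under (it w) k) ->
  adapted k 0 (fun w => z_out (it w) k.-1) ->
  adapted k (2 * t.-1) (fun w => z_in (it w) k t.-1) ->
  adapted k (2 * t).-1 (fun w => z_tilde_in (it w) k t) /\
  adapted k (2 * t) (fun w => z_in (it w) k t).
Proof.
move=> k1 t1 au ao ai.
have Zo w : Z (z_out (it w) k.-1).
  by apply: (z_out_mem Zz0 (run w) T_gt0); lia.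
have Zi w : Z (z_in (it w) k t.-1).
  by apply: (z_in_mem Zz0 (run w) T_gt0) => //; lia.
have Zt w : Z (z_tilde_in (it w) k t) by exact: (z_tilde_in_mem (run w)).
have step w := let: And3 _ _ h := run w in let: And5 _ s _ _ _ := h k k1 in s t t1.
have gu s : adapted k s (fun w => grad G (z_under (it w) k)).
  apply: (measurable_continuous_at (g := grad G)) => [|w].
    exact: (adapted_le (leq0n s) au).
  by have [] := cdG (x := z_under (it w) k) I.
have tilde : adapted k (2 * t).-1 (fun w => z_tilde_in (it w) k t).
  rewrite /adapted; apply: (measurable_argmin (xi := fun w => grad G (z_under (it w) k) +
    Hs (z_in (it w) k t.-1) (zeta k (2 * t).-1 w)) (T := sigma_of sample _)
    Hn cZ cJ pp (be_gt0 k1 t1) Zo Zi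
    (fun w => proj1 (step w))).
  - apply: measurable_rVD; first exact: gu.
    apply: (measurable_oracle_comp (T := sigma_of sample _)
      (W := sample (k, (2 * t).-1)) compZ mHs Zi); first by apply: adapted_le ai; lia.
    apply: (@measurable_sample _ _ _ _ _ sample _ (k, (2 * t).-1)).
    by rewrite mem_past /= eqxx; lia.
  - exact: (adapted_le (leq0n _) ao).
  - by apply: adapted_le ai; lia.
split=> //.
rewrite /adapted; apply: (measurable_argmin (xi := fun w => grad G (z_under (it w) k) +
    Hs (z_tilde_in (it w) k t) (zeta k (2 * t)%N w)) (T := sigma_of sample _)
    Hn cZ cJ pp (be_gt0 k1 t1) Zo Zi
    (fun w => proj2 (step w))).
- apply: measurable_rVD; first exact: gu.
  apply: (measurable_oracle_comp (T := sigma_of sample _)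
    (W := sample (k, (2 * t)%N)) compZ mHs Zt); first by apply: adapted_le tilde; lia.
  apply: (@measurable_sample _ _ _ _ _ sample _ (k, (2 * t)%N)).
  by rewrite mem_past /= eqxx; lia.
- exact: (adapted_le (leq0n _) ao).
- by apply: adapted_le ai; lia.
Qed.

Lemma adapted_under k : (1 <= k <= N)%N ->
  adapted k 0 (fun w => z_out (it w) k.-1) ->
  adapted k 0 (fun w => z_bar (it w) k.-1) ->
  adapted k 0 (fun w => z_under (it w) k).
Proof.
move=> k1 ao ab.
have E w := let: And3 _ _ h := run w in let: And5 (conj e _) _ _ _ _ := h k k1 in e.
rewrite /adapted (funext E).
by apply: measurable_rVD; exact: measurable_rVZ.
Qed.

Lemma adapted_inner k t : (1 <= k <= N)%N -> (t <= T_ p k)%N ->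
  adapted k 0 (fun w => z_out (it w) k.-1) ->
  adapted k 0 (fun w => z_bar (it w) k.-1) ->
  adapted k (2 * t) (fun w => z_in (it w) k t).
Proof.
move=> k1 + ao ab; have au := adapted_under k1 ao ab.
elim: t => [_|t IH tT].
  have E w := let: And3 _ _ h := run w in let: And5 (conj _ e) _ _ _ _ := h k k1 in e.
  by rewrite /adapted (funext E).
have t1 : (1 <= t.+1 <= T_ p k)%N by [].
by have [] := adapted_inner_step k1 t1 au ao (IH (ltnW tT)).
Qed.

Lemma adapted_tilde k t : (1 <= k <= N)%N -> (1 <= t <= T_ p k)%N ->
  adapted k 0 (fun w => z_out (it w) k.-1) ->
  adapted k 0 (fun w => z_bar (it w) k.-1) ->
  adapted k (2 * t).-1 (fun w => z_tilde_in (it w) k t).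
Proof.
move=> k1 t1 ao ab; apply: (proj1 (adapted_inner_step k1 t1 _ ao _)).
  exact: adapted_under.
by apply: adapted_inner => //; lia.
Qed.

(** The iterates are adapted by induction along the order in which the samples are
    drawn. *)
Lemma adapted_outer k : (k < N)%N ->
  adapted k.+1 0 (fun w => z_out (it w) k) /\
  adapted k.+1 0 (fun w => z_bar (it w) k).
Proof.
elim: k => [_|k IH kN].
  have Eo w := let: And3 e _ _ := run w in e.
  have Eb w := let: And3 _ e _ := run w in e.
  by rewrite /adapted (funext Eo) (funext Eb); split; exact: measurable_cst.
have [ao ab] := IH (ltnW kN).
have k1 : (1 <= k.+1 <= N)%N by exact: ltnW.
have Eo w := let: And3 _ _ h := run w in let: And5 _ _ e _ _ := h _ k1 in e.
have Et w := let: And3 _ _ h := run w in let: And5 _ _ _ e _ := h _ k1 in e.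
have Eb w := let: And3 _ _ h := run w in let: And5 _ _ _ _ e := h _ k1 in e.
split; apply: adapted_next => //.
  by rewrite (funext Eo); apply: adapted_inner.
rewrite /adapted (funext Eb); apply: measurable_rVD; apply: measurable_rVZ.
  exact: (adapted_le (leq0n _) ab).
rewrite (funext Et); apply: measurable_rVZ; apply: measurable_rV_sum => t.
rewrite mem_index_iota => t1; apply: (@adapted_le _ (2 * t).-1); first by lia.
exact: adapted_tilde.
Qed.

Hypothesis indep : mutually_independent P (sample_index N p) sample.

Lemma adapted_measurable k s f : adapted k s f ->
  measurable_fun setT (f : T -> borel_rV R n).
Proof. by apply: measurable_of_sigma => i; exact: measurable_funP. Qed.

Lemma adapted_indep k s (f : T -> 'rV[R]_n) : (1 <= k <= N)%N ->
  (s < 2 * T_ p k)%N -> adapted k s f ->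
  forall (A : set (borel_rV R n)) B, measurable A -> measurable B ->
  P (f @^-1` A `&` zeta k s.+1 @^-1` B) = (P (f @^-1` A) * P (zeta k s.+1 @^-1` B))%E.
Proof.
move=> k1 sT af A B mA mB.
apply: (@sigma_of_indep _ _ _ _ _ P _ sample _ _ indep (past (T_ p) k s) (k, s.+1)) => //.
- rewrite mem_past /=; lia.
- move=> [a b]; rewrite mem_past /= => /orP[h|/andP[/eqP -> h]]; rewrite /sample_index/=; lia.
- by rewrite -[X in <<s _ >> X]setTI; exact: af.
Qed.

End adapted_run.

Section mean_bound.
Context d (T : measurableType d) (R : realType) (P : probability T R).
Implicit Types f g : T -> R.

(** Integrability is part of the predicate so that such bounds can be added. *)
Definition mean_le f (b : R) :=
  P.-integrable setT (EFin \o f) /\ (\int[P]_w (f w)%:E <= b%:E)%E.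

Lemma mean_le_cst c : mean_le (cst c) c.
Proof.
split; first exact: finite_measure_integrable_cst.
by have := expectation_cst P c; rewrite unlock => ->.
Qed.

Lemma mean_leD f g a b : mean_le f a -> mean_le g b ->
  mean_le (fun w => f w + g w) (a + b).
Proof.
move=> [fi fa] [gi gb]; split; first exact: (integrableD measurableT fi gi).
under eq_integral do rewrite EFinD.
by rewrite integralD_EFin// EFinD leeD.
Qed.

Lemma mean_leZ c f a : 0 <= c -> mean_le f a -> mean_le (fun w => c * f w) (c * a).
Proof.
move=> c0 [fi fa]; split; first exact: (integrableZl measurableT c fi).
under eq_integral do rewrite EFinM.
by rewrite integralZl// EFinM lee_wpmul2l// lee_fin.
Qed.

Lemma mean_le_sum (I : eqType) (s : seq I) (F : I -> T -> R) (a : I -> R) :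
  (forall i, i \in s -> mean_le (F i) (a i)) ->
  mean_le (fun w => \sum_(i <- s) F i w) (\sum_(i <- s) a i).
Proof.
elim: s => [|i s IH] h.
  by rewrite big_nil; under eq_fun do rewrite big_nil; exact: mean_le_cst.
rewrite big_cons; under eq_fun do rewrite big_cons.
apply: mean_leD; first by apply: h; rewrite mem_head.
by apply: IH => j js; apply: h; rewrite inE js orbT.
Qed.

Lemma mean_le_trans f a b : a <= b -> mean_le f a -> mean_le f b.
Proof. by move=> ab [fi fa]; split=> //; apply: (le_trans fa); rewrite lee_fin. Qed.

End mean_bound.

(** * Total noise and complexity *)

Section step_noise_mean.
Context {R : realType} {n : nat} {nrm : 'rV[R]_n -> R} (Hn : is_norm nrm).
Variables (Z : set 'rV[R]_n) (H : 'rV[R]_n -> 'rV[R]_n) (M : R) (z0 : 'rV[R]_n).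
Hypotheses (compZ : compact Z) (Zz0 : Z z0) (M0 : 0 < M)
  (lH : lipschitz_dual nrm Z H M).
Context dX (X : measurableType dX) (Hs : 'rV[R]_n -> X -> 'rV[R]_n).
Hypothesis mHs : measurable_fun (Z `*` setT : set (borel_rV R n * X))
    (fun zx : borel_rV R n * X => Hs zx.1 zx.2 : borel_rV R n).
Context d (T : measurableType d) (P : probability T R) (sigma : R).

Lemma step_noise_mean_le (s : R) (z : 'rV[R]_n) (V U : T -> 'rV[R]_n) (W1 W2 : T -> X) :
  0 < s -> (forall w, Z (V w)) -> (forall w, Z (U w)) ->
  measurable_fun setT (V : T -> borel_rV R n) ->
  measurable_fun setT (U : T -> borel_rV R n) ->
  measurable_fun setT W1 -> measurable_fun setT W2 ->
  (forall (A : set (borel_rV R n)) B, measurable A -> measurable B ->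
     P (V @^-1` A `&` W1 @^-1` B) = (P (V @^-1` A) * P (W1 @^-1` B))%E) ->
  (forall (A : set (borel_rV R n)) B, measurable A -> measurable B ->
     P (U @^-1` A `&` W2 @^-1` B) = (P (U @^-1` A) * P (W2 @^-1` B))%E) ->
  {ae P, forall w, unbiased_bounded_variance_at P nrm H Hs sigma W1 (V w)} ->
  {ae P, forall w, unbiased_bounded_variance_at P nrm H Hs sigma W2 (U w)} ->
  mean_le P (fun w => step_noise (nrm := nrm) H s z (V w) (U w)
                        (Hs (V w) (W1 w)) (Hs (U w) (W2 w))) (3 * sigma ^+ 2 / s).
Proof.
move=> s0 ZV ZU mV mU mW1 mW2 VW UW oV oU.
have m1 : mean_le P (fun w => dual_norm nrm (Hs (V w) (W1 w) - H (V w)) ^+ 2) (sigma ^+ 2).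
  split.
    exact: (oracle_second_moment_integrable Hn compZ Zz0 M0 lH mHs ZV mV mW1 VW oV).
  exact: (oracle_second_moment Hn compZ Zz0 M0 lH mHs ZV mV mW1 VW oV).
have m2 : mean_le P (fun w => dual_norm nrm (Hs (U w) (W2 w) - H (U w)) ^+ 2) (sigma ^+ 2).
  split.
    exact: (oracle_second_moment_integrable Hn compZ Zz0 M0 lH mHs ZU mU mW2 UW oU).
  exact: (oracle_second_moment Hn compZ Zz0 M0 lH mHs ZU mU mW2 UW oU).
have m3 : mean_le P (fun w => - dot (Hs (U w) (W2 w) - H (U w)) (U w - z)) 0.
  have i3 := oracle_dot_integrable Hn compZ Zz0 M0 lH mHs ZU mU mW2 UW oU z.
  split.
    have := integrableZl measurableT (-1) i3.
    by apply: eq_integrable => // w _ /=; rewrite -EFinM mulN1r.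
  under eq_integral do rewrite -mulN1r EFinM.
  rewrite integralZl// (oracle_dot_mean0 Hn compZ Zz0 M0 lH mHs ZU mU mW2 UW oU).
  by rewrite mule0.
have c0 : 0 <= 3 / (2 * s) by rewrite divr_ge0// mulr_ge0// ltW.
have := mean_leD (mean_leZ c0 (mean_leD m1 m2)) m3.
rewrite addr0 /step_noise.
have -> : 3 / (2 * s) * (sigma ^+ 2 + sigma ^+ 2) = 3 * sigma ^+ 2 / s.
  by field; rewrite lt0r_neq0.
by under eq_fun do rewrite mulrAC.
Qed.

End step_noise_mean.

Section rates.
Context {R : realType}.
Variables (L M sigma Om : R).
Hypotheses (L0 : 0 < L) (M0 : 0 < M) (Om0 : 0 < Om).

(** The variance part of [inner_steps] is chosen so that each outer iteration
    contributes at most [6 * Om * L / N]. *)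
Lemma sliding_noise_budget N (p := sliding_params L M sigma Om N) : (0 < N)%N ->
  \sum_(1 <= k < N.+1) 2 * k%:R / (T_ p k)%:R *
      \sum_(1 <= t < (T_ p k).+1) (3 * sigma ^+ 2 / (beta_ p k + eta_ p k t))
  <= 6 * Om * L.
Proof.
move=> N0.
have NR : 0 < (N%:R : R) by rewrite ltr0n.
have -> : 6 * Om * L = \sum_(1 <= k < N.+1) (6 * Om * L / N%:R).
  by rewrite sumr_const_nat subn1/= -[X in _ = X]mulr_natr divfK// gt_eqF.
rewrite !big_seq; apply: ler_sum => k; rewrite mem_index_iota => /andP[k0 kN].
have kR : 0 < (k%:R : R) by rewrite ltr0n.
have T0 : 0 < ((T_ p k)%:R : R) by rewrite ltr0n; exact: inner_steps_gt0.
set Tk : R := (T_ p k)%:R in T0 *.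
have h t : (1 <= t < (T_ p k).+1)%N ->
    3 * sigma ^+ 2 / (beta_ p k + eta_ p k t) <= 3 * sigma ^+ 2 * k%:R / (L * Tk).
  move=> /andP[t0 _]; rewrite -[leRHS]mulrA; apply: ler_wpM2l; first by rewrite mulr_ge0 ?sqr_ge0.
  have e : L * Tk / k%:R <= eta_ p k t.+1 by exact: sliding_eta_ge.
  rewrite sliding_etaS in e.
  have q : 0 < L * Tk / k%:R by rewrite divr_gt0// mulr_gt0.
  rewrite -[k%:R / _]invf_div lef_pV2 ?posrE//; exact: lt_le_trans q e.
apply: le_trans (_ : 2 * k%:R / Tk * \sum_(1 <= t < (T_ p k).+1)
    (3 * sigma ^+ 2 * k%:R / (L * Tk)) <= _).
  apply: ler_wpM2l; first by rewrite divr_ge0 ?mulr_ge0// ltW.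
  by rewrite !big_seq; apply: ler_sum => t; rewrite mem_index_iota; exact: h.
rewrite sumr_const_nat subn1/= -[_ / (L * Tk) *+ _]mulr_natr -/Tk.
have -> : 2 * k%:R / Tk * (3 * sigma ^+ 2 * k%:R / (L * Tk) * Tk) =
    6 * (k%:R ^+ 2 * sigma ^+ 2) / (L * Tk).
  by field; rewrite !lt0r_neq0.
have /andP[Tge _] := inner_steps_bounds sigma L0 M0 Om0 N k0.
have Tge' : N%:R * k%:R ^+ 2 * sigma ^+ 2 / (Om * L ^+ 2) <= Tk.
  apply: le_trans Tge; rewrite lerDr.
  by rewrite !mulr_ge0 ?sqrtr_ge0 ?invr_ge0// ltW.
rewrite ler_pdivrMr ?mulr_gt0 ?exprn_gt0// in Tge'.
rewrite ler_pdivrMr ?mulr_gt0//.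
rewrite -(ler_pM2r NR).
have -> : 6 * Om * L / N%:R * (L * Tk) * N%:R = 6 * (Tk * (Om * L ^+ 2)).
  by field; rewrite lt0r_neq0.
move: Tge'; lra.
Qed.

Variable eps : R.
Hypothesis eps_le : 0 < eps <= L * Om.

(** The smallest [N] with [12 * L * Om <= eps * N ^+ 2]; the expected gap is at most
    [12 * L * Om / (N * N.+1)]. *)
Definition outer_count : nat := `|Num.ceil (Num.sqrt (12 * (L * Om / eps)))|%N.

Let x := L * Om / eps.

Let x1 : 1 <= x.
Proof. by move/andP: eps_le => [e0 h]; rewrite /x ler_pdivlMr// mul1r. Qed.

Let s1 : 1 <= Num.sqrt x.
Proof. by rewrite -[leLHS]sqrtr1 ler_sqrt// (le_trans ler01 x1). Qed.

Let sq : Num.sqrt x ^+ 2 = x.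
Proof. by rewrite sqr_sqrtr// (le_trans ler01 x1). Qed.

Let count_bounds : Num.sqrt (12 * x) <= outer_count%:R < Num.sqrt (12 * x) + 1.
Proof.
have x0 : 0 < 12 * x by rewrite mulr_gt0// (lt_le_trans ltr01 x1).
have c0 : (0 <= Num.ceil (Num.sqrt (12 * x)))%R.
  by rewrite ltW// -[0]/(0%:Z) ceil_gt0 sqrtr_gt0.
rewrite /outer_count -/x natr_absz ger0_norm// ceil_ge/= -ltrBlDr.
by have := ceilB1_lt (Num.sqrt (12 * x)); rewrite rmorphB.
Qed.

Lemma outer_count_gt0 : (0 < outer_count)%N.
Proof.
rewrite -(ltr0n R); have /andP[+ _] := count_bounds; apply: lt_le_trans.
by rewrite sqrtr_gt0 mulr_gt0// (lt_le_trans ltr01 x1).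
Qed.

Lemma outer_count_ge : 12 * (L * Om / eps) <= outer_count%:R ^+ 2.
Proof.
have /andP[h _] := count_bounds; rewrite -/x.
have x0 : 0 <= 12 * x by rewrite mulr_ge0// (le_trans ler01 x1).
by rewrite -(sqr_sqrtr x0) ler_sqr// nnegrE ?sqrtr_ge0.
Qed.

Lemma outer_count_le : outer_count%:R <= 5 * Num.sqrt (L * Om / eps).
Proof.
have /andP[_ /ltW h] := count_bounds; apply: (le_trans h).
have x0 : 0 <= x by exact: (le_trans ler01 x1).
rewrite sqrtrM// -/x.
have s12 : Num.sqrt (12 : R) <= 4.
  by rewrite -[leRHS]ger0_norm// -sqrtr_sqr ler_sqrt// expr2; lra.
have : Num.sqrt 12 * Num.sqrt x <= 4 * Num.sqrt x by rewrite ler_wpM2r ?sqrtr_ge0.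
move: s1; lra.
Qed.

Lemma grad_evalsE N : grad_evals N = N.
Proof. by rewrite /grad_evals sum_nat_const_nat subn1 muln1. Qed.

(** Summing the bound on [inner_steps] at [k = N] gives terms in [N ^+ 2], [N ^+ 4]
    and [N], where [N <= 5 * sqrt (L * Om / eps)]; the constant is [2 * 5 ^+ 4]. *)
Lemma oracle_evals_le (N := outer_count) :
  (oracle_evals N (sliding_params L M sigma Om N))%:R <=
    1250 * (M * Om / eps + sigma ^+ 2 * Om / eps ^+ 2 + Num.sqrt (L * Om / eps)).
Proof.
have [e0 eh] := andP eps_le.
have Nle := outer_count_le; rewrite -/x -/N in Nle.
have N0 : 0 <= (N%:R : R) by [].
have s0 : 0 <= Num.sqrt x by exact: sqrtr_ge0.
have N2 : (N%:R : R) ^+ 2 <= 25 * x.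
  have -> : 25 * x = (5 * Num.sqrt x) ^+ 2 by rewrite exprMn sq; ring.
  by rewrite ler_sqr// nnegrE mulr_ge0.
have N4 : (N%:R : R) ^+ 4 <= 625 * x ^+ 2.
  have -> : 625 * x ^+ 2 = (25 * x) ^+ 2 by ring.
  by rewrite (exprM _ 2 2) ler_sqr// nnegrE ?sqr_ge0// mulr_ge0// (le_trans ler01 x1).
have s3 : Num.sqrt (3 : R) <= 2.
  by rewrite -[leRHS]ger0_norm// -sqrtr_sqr ler_sqrt// expr2; lra.
have step k : (1 <= k < N.+1)%N ->
    ((2 * T_ (sliding_params L M sigma Om N) k)%N)%:R <=
    2 * (2 * N%:R * M / L + N%:R ^+ 3 * sigma ^+ 2 / (Om * L ^+ 2) + 1).
  move=> /andP[k0 kN]; rewrite natrM ler_wpM2l//.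
  have /andP[_ /ltW h] := inner_steps_bounds sigma L0 M0 Om0 N k0.
  apply: (le_trans h); rewrite lerD2r.
  have kNR : (k%:R : R) <= N%:R by rewrite ler_nat.
  apply: lerD.
    apply: ler_wpM2r; first by rewrite invr_ge0 ltW.
    apply: ler_wpM2r; first exact: ltW.
    by apply: ler_pM => //; exact: sqrtr_ge0.
  apply: ler_wpM2r; first by rewrite invr_ge0 mulr_ge0 ?sqr_ge0// ltW.
  apply: ler_wpM2r; first exact: sqr_ge0.
  by rewrite exprS ler_wpM2l// ler_sqr ?nnegrE.
have -> : (oracle_evals N (sliding_params L M sigma Om N))%:R =
    \sum_(1 <= k < N.+1) ((2 * T_ (sliding_params L M sigma Om N) k)%N)%:R :> R.
  by rewrite /oracle_evals natr_sum.
apply: le_trans (_ : \sum_(1 <= k < N.+1) (2 * (2 * N%:R * M / L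
    + N%:R ^+ 3 * sigma ^+ 2 / (Om * L ^+ 2) + 1)) <= _).
  by rewrite !big_seq; apply: ler_sum => k; rewrite mem_index_iota; exact: step.
rewrite sumr_const_nat subn1/= -[2 * (_ + 1) *+ N]mulr_natl.
have -> : N%:R * (2 * (2 * N%:R * M / L + N%:R ^+ 3 * sigma ^+ 2 / (Om * L ^+ 2) + 1)) =
    4 * (M / L) * N%:R ^+ 2 + 2 * (sigma ^+ 2 / (Om * L ^+ 2)) * N%:R ^+ 4 + 2 * N%:R.
  by field; rewrite !lt0r_neq0.
have a1 : 4 * (M / L) * N%:R ^+ 2 <= 4 * (M / L) * (25 * x).
  by rewrite ler_wpM2l// mulr_ge0// divr_ge0// ltW.
have a2 : 2 * (sigma ^+ 2 / (Om * L ^+ 2)) * N%:R ^+ 4 <=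
    2 * (sigma ^+ 2 / (Om * L ^+ 2)) * (625 * x ^+ 2).
  rewrite ler_wpM2l// mulr_ge0// divr_ge0 ?sqr_ge0//.
  by rewrite mulr_ge0 ?sqr_ge0// ltW.
have b1 : 4 * (M / L) * (25 * x) = 100 * (M * Om / eps).
  by rewrite /x; field; rewrite !lt0r_neq0.
have b2 : 2 * (sigma ^+ 2 / (Om * L ^+ 2)) * (625 * x ^+ 2) =
    1250 * (sigma ^+ 2 * Om / eps ^+ 2).
  by rewrite /x; field; rewrite !lt0r_neq0.
have c1 : 0 <= M * Om / eps by rewrite divr_ge0 ?mulr_ge0// ltW.
rewrite b1 in a1; rewrite b2 in a2; rewrite -/x; move: a1 a2 Nle c1 s0; lra.
Qed.

End rates.

(** * Expected gap *)

Section convergence.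
Context {R : realType} {n : nat} {nrm : 'rV[R]_n -> R} (Hn : is_norm nrm).
Variables (Z : set 'rV[R]_n) (G J pi : 'rV[R]_n -> R) (H : 'rV[R]_n -> 'rV[R]_n).
Variables (L M sigma : R) (z0 : 'rV[R]_n) (N : nat).
Hypotheses (compZ : compact Z) (cZ : convex_set Z) (cG : convex_function setT G)
  (cdG : cont_diff_on setT G) (mH : monotone_operator H)
  (L0 : 0 < L) (M0 : 0 < M)
  (lG : lipschitz_dual nrm Z (grad G) L) (lH : lipschitz_dual nrm Z H M)
  (pp : prox_function nrm Z pi) (cJ : convex_function Z J).
Context dX (X : measurableType dX) (Hs : 'rV[R]_n -> X -> 'rV[R]_n).
Hypothesis mHs : measurable_fun (Z `*` setT : set (borel_rV R n * X))
    (fun zx : borel_rV R n * X => Hs zx.1 zx.2 : borel_rV R n).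
Hypothesis Zz0 : Z z0.
Let Om := bregman_radius pi Z z0.
Hypothesis Om0 : 0 < Om.
Let p := sliding_params L M sigma Om N.
Context d (T : measurableType d) (P : probability T R).
Variables (zeta : nat -> nat -> {RV P >-> X}) (it : T -> smps_iterates R n).
Hypothesis indep : mutually_independent P (sample_index N p)
  (fun ks => zeta ks.1 ks.2 : T -> X).
Hypothesis run : forall w, smps_run Z G J pi Hs z0 N p (fun k s => zeta k s w) (it w).
Hypothesis oracle : oracle_along_run P nrm H Hs sigma N p zeta it.
Hypothesis N0 : (0 < N)%N.

Lemma bregman_le_radius z : Z z -> bregman pi z0 z <= Om.
Proof.
move=> Zz; have [hs|hs] := pselect (has_sup [set bregman pi z0 z | z in Z]).
  by apply: (ub_le_sup (proj2 hs)); exists z.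
(* An unbounded set would have [sup] equal to [0]. *)
by move: Om0; rewrite /Om /bregman_radius sup_out// ltxx.
Qed.

Let T_gt0 k : (1 <= k <= N)%N -> (0 < T_ p k)%N.
Proof. exact: sliding_T_gt0. Qed.

Let be_gt0 k t : (1 <= k <= N)%N -> (1 <= t <= T_ p k)%N ->
  0 < beta_ p k + eta_ p k t.
Proof.
move=> /andP[k0 kN] t1; rewrite -sliding_etaS.
have e : Num.sqrt 3 * M <= eta_ p k t.+1 by exact: sliding_eta_geM.
by apply: lt_le_trans e; rewrite mulr_gt0// sqrtr_gt0.
Qed.

Let noise_mean_le z k t : (1 <= k <= N)%N -> (1 <= t <= T_ p k)%N ->
  mean_le P (fun w => noise (nrm := nrm) H Hs p (fun k s => zeta k s w) (it w) z k t)
    (3 * sigma ^+ 2 / (beta_ p k + eta_ p k t)).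
Proof.
move=> k1 t1.
have kN : (k.-1 < N)%N by lia.
have [ao ab] := adapted_outer Hn compZ cZ cdG pp cJ mHs Zz0 run T_gt0 be_gt0 kN.
have k0 : (0 < k)%N by lia.
rewrite prednK// in ao ab.
have adi : adapted p zeta k (2 * t.-1) (fun w => z_in (it w) k t.-1).
  by apply: (adapted_inner Hn compZ cZ cdG pp cJ mHs Zz0 run T_gt0 be_gt0) => //; lia.
have adt : adapted p zeta k (2 * t).-1 (fun w => z_tilde_in (it w) k t).
  by apply: (adapted_tilde Hn compZ cZ cdG pp cJ mHs Zz0 run T_gt0 be_gt0).
have [q1 q2] := oracle k1 t1.
apply: (step_noise_mean_le Hn compZ Zz0 M0 lH mHs).
- exact: be_gt0.
- by move=> w; apply: (z_in_mem Zz0 (run w) T_gt0) => //; lia.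
- by move=> w; exact: (z_tilde_in_mem (run w)).
- exact: (adapted_measurable adi).
- exact: (adapted_measurable adt).
- exact: measurable_funP.
- exact: measurable_funP.
- have -> : ((2 * t).-1 = (2 * t.-1).+1)%N by lia.
  by apply: (adapted_indep indep k1 _ adi); lia.
- have -> : (2 * t = ((2 * t).-1).+1)%N by lia.
  by apply: (adapted_indep indep k1 _ adt); lia.
- exact: q1.
- exact: q2.
Qed.

(** The gap need not be a measurable function of the outcome; it is bounded
    pointwise by an integrable function with a controlled mean. *)
Lemma expected_gap_le z : Z z ->
  ('E_P[fun w => gap G H J (z_bar (it w) N) z] <=
    (12 * L * Om / (N%:R * N.+1%:R))%:E)%E.
Proof.
move=> Zz; have dG x : differentiable G x by have [] := cdG (x := x) I.
have NN : 0 < (N%:R * N.+1%:R : R) by rewrite mulr_gt0// ltr0n.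
pose S w := \sum_(1 <= k < N.+1) 2 * k%:R / (T_ p k)%:R *
  \sum_(1 <= t < (T_ p k).+1)
    noise (nrm := nrm) H Hs p (fun k s => zeta k s w) (it w) z k t.
pose F w := (N%:R * N.+1%:R)^-1 * (6 * L * Om + S w).
have gF w : gap G H J (z_bar (it w) N) z <= F w.
  rewrite /F ler_pdivlMl//.
  apply: (le_trans (sliding_gap_bound Hn cZ cG dG mH L0 M0 Om0 lG lH pp cJ Zz0 (run w) Zz)).
  rewrite lerD2r ler_wpM2l ?bregman_le_radius// mulr_ge0//; exact: ltW.
have mS : mean_le P S (6 * Om * L).
  apply: mean_le_trans (sliding_noise_budget sigma L0 M0 Om0 N0) _.
  apply: mean_le_sum => k; rewrite mem_index_iota => k1.
  apply: mean_leZ; first by rewrite divr_ge0// mulr_ge0.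
  apply: mean_le_sum => t; rewrite mem_index_iota => t1.
  exact: noise_mean_le.
have mF : mean_le P F (12 * L * Om / (N%:R * N.+1%:R)).
  have NNi : 0 <= (N%:R * N.+1%:R : R)^-1 by rewrite invr_ge0 ltW.
  have := mean_leZ NNi (mean_leD (mean_le_cst P (6 * L * Om)) mS).
  by apply: mean_le_trans; rewrite mulrC ler_wpM2r//; lra.
rewrite unlock; apply: le_trans (proj2 mF).
by apply: le_integral_lower => w; rewrite lee_fin.
Qed.

End convergence.

Theorem corollary3p3 (R : realType) :
  exists C : R,
  forall (n : nat) (Z : set 'rV[R]_n) (nrm : 'rV[R]_n -> R)
    (G J pi : 'rV[R]_n -> R) (H : 'rV[R]_n -> 'rV[R]_n)
    (dX : measure_display) (X : measurableType dX)
    (Hs : 'rV[R]_n -> X -> 'rV[R]_n)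
    (L M sigma : R) (z0 : 'rV[R]_n) (eps : R),
  Z !=set0 -> compact Z -> convex_set Z ->
  is_norm nrm ->
  convex_function setT G -> cont_diff_on setT G ->
  monotone_operator H ->
  0 < L -> 0 < M ->
  lipschitz_dual nrm Z (grad G) L -> lipschitz_dual nrm Z H M ->
  prox_function nrm Z pi ->
  convex_function Z J -> simple_on Z J pi ->
  measurable_fun (Z `*` setT : set (borel_rV R n * X))
    (fun zx : borel_rV R n * X => Hs zx.1 zx.2 : borel_rV R n) ->
  Z z0 ->
  let Om := bregman_radius pi Z z0 in
  0 < Om -> 0 < eps <= L * Om ->
  exists N : nat,
    let p := sliding_params L M sigma Om N in
    [/\ (1 <= N)%N,
        (grad_evals N)%:R <= C * Num.sqrt (L * Om / eps),
        (oracle_evals N p)%:R <=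
          C * (M * Om / eps + sigma ^+ 2 * Om / eps ^+ 2
               + Num.sqrt (L * Om / eps)) &
        forall (d : measure_display) (T : measurableType d)
          (P : probability T R) (zeta : nat -> nat -> {RV P >-> X})
          (it : T -> smps_iterates R n),
        mutually_independent P (sample_index N p)
          (fun ks => zeta ks.1 ks.2 : T -> X) ->
        (forall w : T,
          smps_run Z G J pi Hs z0 N p (fun k s => zeta k s w) (it w)) ->
        oracle_along_run P nrm H Hs sigma N p zeta it ->
        (ereal_sup [set 'E_P[fun w => gap G H J (z_bar (it w) N) z] | z in Z]
           <= eps%:E)%E].
Proof.
exists 1250 => n Z nrm G J pi H dX X Hs L M sigma z0 eps _ compZ cZ Hn cG cdG mH
  L0 M0 lG lH pp cJ _ mHs Zz0 Om Om0 epsOm.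
pose N := outer_count L Om eps.
have N0 : (0 < N)%N by exact: outer_count_gt0.
exists N => p; split => //.
- rewrite grad_evalsE; apply: (le_trans (outer_count_le epsOm)).
  by rewrite ler_wpM2r ?sqrtr_ge0// ler_nat.
- exact: oracle_evals_le.
move=> d T P zeta it ind run ora; apply: ge_ereal_sup => _ [z Zz <-].
apply: (le_trans (expected_gap_le Hn compZ cZ cG cdG mH L0 M0 lG lH pp cJ mHs
  Zz0 Om0 ind run ora N0 Zz)).
have [e0 _] := andP epsOm.
have NR : 0 < (N%:R : R) by rewrite ltr0n.
rewrite lee_fin ler_pdivrMr; last by rewrite mulr_gt0// ltr0n.
have := outer_count_ge epsOm; rewrite -/N mulrA ler_pdivrMr// => h.
rewrite -/Om -mulrA; apply: (le_trans h).
rewrite mulrC ler_pM2l// expr2 ler_pM2l// ler_nat; exact: leqnSn.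
Qed.
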